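(* Let $(M,g)$ be an oriented Riemannian 4-manifold that is $*_L$-Einstein with respect to a unit length vector field $T$, and let $g_L:=g-2T^\flat\otimes T^\flat$. Let $p\in M$. If $P\in G_+(p)\cup G_-(p)$ is orthogonal to $T$ or contains $T$, then $P$ is an eigenvector of the complex-linear map $\hat R_g\colon\Lambda^2_{\mathbb C}\to\Lambda^2_{\mathbb C}$ if and only if $P$ is a critical point of the sectional curvature function $\mathrm{sec}_g$.
   Context: Write $T^\flat := g(T,\cdot)$ and $\Lambda^2 := \Lambda^2(T_pM)$. For a metric $m$ of any signature, $\Lambda^2$ carries the inner product $\langle v_1\wedge w_1, v_2\wedge w_2\rangle_m := m(v_1,v_2)m(w_1,w_2) - m(v_1,w_2)m(w_1,v_2)$, and the Hodge star $*_m\colon\Lambda^2\to\Lambda^2$ is defined by $\xi\wedge *_m\eta = \langle\xi,\eta\rangle_m\, dV$, where $dV = e_1\wedge e_2\wedge e_3\wedge e_4$ for any oriented $m$-orthonormal basis. Here $*_L$ is the Hodge star of the Lorentzian metric $g_L$; it satisfies $*_L^2=-1$. Curvature convention: $R(a,b,c,d) := g(\nabla_a\nabla_b c-\nabla_b\nabla_a c-\nabla_{[a,b]}c,d)$; the curvature operator $\hat R_g\colon\Lambda^2\to\Lambda^2$ of $g$ is defined by $\langle\hat R_g(v\wedge w),x\wedge y\rangle_g = -R(v,w,x,y)$. $(M,g)$ is $*_L$-Einstein (with respect to the unit length vector field $T$) if $\hat R_g\circ *_L=*_L\circ\hat R_g$. $\Lambda^2_{\mathbb C}$ denotes $\Lambda^2$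 regarded as a 3-dimensional complex vector space via $i\xi:=*_L\xi$; for $*_L$-Einstein $g$ the operator $\hat R_g$ is complex-linear on it. $G_{\pm}(p)\subseteq\Lambda^2(T_pM)$ is the set of decomposable 2-vectors $P$ with $\langle P,P\rangle_{g_L}=\pm1$, i.e. the oriented 2-planes nondegenerate for $g_L$. The sectional curvature $\mathrm{sec}_g(P)=\langle\hat R_gP,P\rangle_g$ is regarded as a smooth function on the Grassmannian of $g$-unit decomposable 2-vectors in $\Lambda^2(T_pM)$ (oriented 2-planes). (A $P\in G_+(p)\cup G_-(p)$ that contains $T$ or is orthogonal to $T$ is also of $g$-unit length.) *)

(* Defs.v *)
From mathcomp Require Import all_boot all_order all_algebra.
From mathcomp Require Import all_classical all_reals all_analysis.
From mathcomp Require Import complex.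
From mathcomp Require Import ring.

Set Implicit Arguments.
Unset Strict Implicit.
Unset Printing Implicit Defensive.
Import Order.TTheory GRing.Theory Num.Theory.
Import numFieldNormedType.Exports.
Local Open Scope classical_set_scope.
Local Open Scope ring_scope.

(* Row vectors are used throughout: a linear map acts by [v *m A], and 'J f x
   satisfies 'd f x v = v *m 'J f x. *)

Definition ebase {R : realType} (i : 'I_4) : 'rV[R]_4 := delta_mx 0 i.

Fixpoint Ck {R : realType} {V W : normedModType R} (k : nat) (U : set V)
    (f : V -> W) : Prop :=
  if k is k'.+1 then
    (forall x, U x -> differentiable f x) /\
    (forall v : V, Ck k' U (fun x => 'D_v f x))
  else forall x, U x -> {for x, continuous f}.

(* Only used for open U, so that the values of f outside U are irrelevant. *)
Definition smooth_on {R : realType} {V W : normedModType R} (U : set V)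
    (f : V -> W) : Prop := forall k, Ck k U f.

(* The inverse homeomorphism [cinv] is total; only its values on [ccod]
   matter. *)
Record chart (R : realType) (M : topologicalType) := Chart {
  cdom : set M;
  cmap :> M -> 'rV[R]_4;
  cinv : 'rV[R]_4 -> M;
  ccod : set 'rV[R]_4 := cmap @` cdom;
  cdom_open : open cdom;
  ccod_open : open ccod;
  cmapK : forall p, cdom p -> cinv (cmap p) = p;
  cmap_cont : forall p, cdom p -> {for p, continuous cmap};
  cinv_cont : forall x, ccod x -> {for x, continuous cinv} }.

Definition transition {R : realType} {M : topologicalType}
    (phi psi : chart R M) : 'rV[R]_4 -> 'rV[R]_4 := psi \o cinv phi.

(* The orientation is the one for which all the charts of the atlas are
   positively oriented. *)
Record oriented_manifold4 (R : realType) := OrientedManifold4 {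
  space :> topologicalType;
  space_hausdorff : hausdorff_space space;
  space_countable : @second_countable space;
  atlas : set (chart R space);
  atlas_cover : forall p, exists2 phi, atlas phi & cdom phi p;
  atlas_smooth : forall phi psi, atlas phi -> atlas psi ->
    smooth_on (phi @` (cdom phi `&` cdom psi)) (transition phi psi);
  atlas_oriented : forall phi psi p, atlas phi -> atlas psi ->
    cdom phi p -> cdom psi p -> 0 < \det ('J (transition phi psi) (phi p)) }.

(* A tensor field is given by its components in every chart of the atlas, as
   functions of the coordinates, subject to the transformation law.  For a chart
   phi at p, T_pM is identified with 'rV_4 by means of the coordinate basis. *)

Record vector_field (R : realType) (M : oriented_manifold4 R) := VectorField {
  vcoord :> chart R M -> 'rV[R]_4 -> 'rV[R]_4;
  vcoord_smooth : forall phi, atlas phi -> smooth_on (ccod phi) (vcoord phi);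
  vcoord_compat : forall phi psi p, atlas phi -> atlas psi ->
    cdom phi p -> cdom psi p ->
    vcoord psi (psi p) = vcoord phi (phi p) *m 'J (transition phi psi) (phi p) }.

Definition ip {R : realType} (m : 'M[R]_4) (v w : 'rV[R]_4) : R :=
  (v *m m *m w^T) 0 0.

Record riemannian_metric (R : realType) (M : oriented_manifold4 R) :=
    RiemannianMetric {
  gcoord :> chart R M -> 'rV[R]_4 -> 'M[R]_4;
  gcoord_smooth : forall phi, atlas phi -> smooth_on (ccod phi) (gcoord phi);
  gcoord_sym : forall phi x, atlas phi -> ccod phi x ->
    (gcoord phi x)^T = gcoord phi x;
  gcoord_pos : forall phi x v, atlas phi -> ccod phi x -> v != 0 ->
    0 < ip (gcoord phi x) v v;
  gcoord_compat : forall phi psi p, atlas phi -> atlas psi ->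
    cdom phi p -> cdom psi p ->
    let J := 'J (transition phi psi) (phi p) in
    gcoord phi (phi p) = J *m gcoord psi (psi p) *m J^T }.

Section Curvature.
Context {R : realType} (G : 'rV[R]_4 -> 'M[R]_4).
Implicit Types (a b c d : 'rV[R]_4 -> 'rV[R]_4) (x : 'rV[R]_4).

(* g(nabla_i e_j, e_k) for coordinate fields, by the Koszul formula. *)
Definition christoffel1 x (i j k : 'I_4) : R :=
  2^-1 * ('D_(ebase i) (fun y => G y j k) x + 'D_(ebase j) (fun y => G y i k) x
          - 'D_(ebase k) (fun y => G y i j) x).

Definition christoffel x (u v : 'rV[R]_4) : 'rV[R]_4 :=
  (\row_k \sum_i \sum_j u 0 i * v 0 j * christoffel1 x i j k) *m invmx (G x).

Definition covd a b : 'rV[R]_4 -> 'rV[R]_4 :=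
  fun x => 'D_(a x) b x + christoffel x (a x) (b x).

Definition lie_bracket a b : 'rV[R]_4 -> 'rV[R]_4 :=
  fun x => 'D_(a x) b x - 'D_(b x) a x.

Definition riemann a b c d x : R :=
  ip (G x) (covd a (covd b c) x - covd b (covd a c) x
            - covd (lie_bracket a b) c x) (d x).

(* By tensoriality, the value on tangent vectors at x can be computed on any
   extension; we take the extension with constant components. *)
Definition riemann_at x (v w y z : 'rV[R]_4) : R :=
  riemann (cst v) (cst w) (cst y) (cst z) x.

End Curvature.

(* Lambda^2 of 'rV_4 is the space of skew-symmetric matrices, with
   v /\ w = v^T w - w^T v; thus xi is the sum over i < j of
   xi i j *: e_i /\ e_j. *)

Section TwoVectors.
Context {R : realType}.
Implicit Types (m A B xi eta P : 'M[R]_4) (v w x y T : 'rV[R]_4).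

Definition is_2vector xi : Prop := xi^T = - xi.

Definition wedge v w : 'M[R]_4 := v^T *m w - w^T *m v.

Definition decomposable P : Prop := exists v w, P = wedge v w.

(* The bilinear extension of
   <v1 /\ w1, v2 /\ w2>_m = m(v1,v2) m(w1,w2) - m(v1,w2) m(w1,v2);
   see ip2_wedge. *)
Definition ip2 m xi eta : R := 2^-1 * \tr (xi^T *m (m *m eta *m m^T)).

(* The coefficient of xi /\ eta on e_0 /\ e_1 /\ e_2 /\ e_3; see
   wedge22_wedge. *)
Definition wedge22 xi eta : R :=
  xi 0 1 * eta 2 3 - xi 0 2 * eta 1 3 + xi 0 3 * eta 1 2
  + xi 1 2 * eta 0 3 - xi 1 3 * eta 0 2 + xi 2 3 * eta 0 1.

(* The coefficient of the volume element dV of m; see dvol_orthonormal. *)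
Definition dvol m : R := (Num.sqrt `|\det m|)^-1.

(* The unique 2-vector such that xi /\ hodge m eta = <xi, eta>_m dV for all
   2-vectors xi; see hodgeP. *)
Definition hodge m eta : 'M[R]_4 :=
  dvol m *: \matrix_(i, j) wedge22 (wedge (ebase i) (ebase j))
                                   (m *m eta *m m^T).

(* The operator with <curv_op G Rm (v /\ w), x /\ y>_G = - Rm v w x y; see
   curv_opP.  The sum over all i and j counts every e_i /\ e_j twice. *)
Definition curv_op (G : 'M[R]_4)
    (Rm : 'rV[R]_4 -> 'rV[R]_4 -> 'rV[R]_4 -> 'rV[R]_4 -> R) xi : 'M[R]_4 :=
  invmx G *m
  (\matrix_(k, l) - (2^-1 * \sum_i \sum_j
     xi i j * Rm (ebase i) (ebase j) (ebase k) (ebase l))) *m (invmx G)^T.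

(* The plane of a nonzero decomposable P is its row space; see
   wedge_plane. *)
Definition plane_contains T P : Prop := (T <= P)%MS.

Definition plane_orthogonal m T P : Prop :=
  forall u : 'rV[R]_4, (u <= P)%MS -> ip m u T = 0.

End TwoVectors.

Section TwoVectorFacts.
Context {R : realType}.
Implicit Types (m E A B xi eta P : 'M[R]_4) (v w x y T : 'rV[R]_4).

Lemma wedge_2vector v w : is_2vector (wedge v w).
Proof.
by rewrite /is_2vector /wedge linearB /= !trmx_mul !trmxK opprB.
Qed.

Let mx11E (a : 'M[R]_1) : a = (a 0 0)%:M.
Proof. exact: mx11_scalar. Qed.

Let tr_rank1 m a b c d :
  \tr (a^T *m b *m (m *m (c^T *m d) *m m^T)) = ip m b c * ip m a d.
Proof.
have -> : a^T *m b *m (m *m (c^T *m d) *m m^T) =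
    a^T *m ((b *m m *m c^T) *m (d *m m^T)) by rewrite !mulmxA.
rewrite mxtrace_mulC [b *m m *m c^T]mx11E mul_scalar_mx -scalemxAl.
rewrite linearZ /= -/(ip m b c); congr (_ * _).
rewrite [_ *m a^T]mx11E mxtrace_scalar mulr1n.
by rewrite /ip -[in RHS](trmxK (a *m m *m d^T)) [RHS]mxE !trmx_mul trmxK mulmxA.
Qed.

Lemma ip2_wedge m v1 w1 v2 w2 :
  ip2 m (wedge v1 w1) (wedge v2 w2) =
  ip m v1 v2 * ip m w1 w2 - ip m v1 w2 * ip m w1 v2.
Proof.
rewrite /ip2 wedge_2vector /wedge opprB !(mulmxBl, mulmxBr) !linearB /=.
by rewrite !tr_rank1; field.
Qed.

Let sum4 (V : zmodType) (F : 'I_4 -> V) :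
  \sum_i F i = F 0 + F 1 + F 2 + F 3.
Proof.
rewrite !big_ord_recl big_ord0 addr0 !addrA.
by congr (_ + _ + _ + _); congr F; apply/val_inj.
Qed.

Let wedgeE v w i j : wedge v w i j = v 0 i * w 0 j - w 0 i * v 0 j.
Proof. by rewrite !mxE !big_ord1 !mxE. Qed.

Lemma wedge22_wedge v w x y :
  wedge22 (wedge v w) (wedge x y) =
  \det (\matrix_(i < 4) [:: v; w; x; y]`_i).
Proof.
pose f (z : 'rV[R]_4) n := z 0 (inord n).
have fE (z : 'rV[R]_4) i : z 0 i = f z i by rewrite /f inord_val.
rewrite (expand_det_row _ (0 : 'I_4)) !big_ord_recl !big_ord0 /cofactor.
rewrite !(expand_det_row _ (0 : 'I_3)) !big_ord_recl !big_ord0 /cofactor.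
rewrite !(expand_det_row _ (0 : 'I_2)) !big_ord_recl !big_ord0 /cofactor.
rewrite !det_mx11 !mxE /wedge22 !wedgeE !fE /= /bump /=.
by ring.
Qed.

(* The rows of E are a positively oriented m-orthonormal basis. *)
Lemma dvol_orthonormal m E :
    (forall i, `|ip m (row i E) (row i E)| = 1) ->
    (forall i j, i != j -> ip m (row i E) (row j E) = 0) ->
    0 < \det E ->
  \det E = dvol m.
Proof.
move=> E1 E0 E_gt0.
have EmE i j : (E *m m *m E^T) i j = ip m (row i E) (row j E).
  rewrite /ip -row_mul mxE [RHS]mxE.
  by apply: eq_bigr => k _; rewrite [RHS]mulrC [RHS]mulrC !mxE.
have : `|\det (E *m m *m E^T)| = 1.
  rewrite det_trig; last first.
    apply/is_trig_mxP => i j ij; rewrite EmE E0 //.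
    by apply: contraTN ij => /eqP ->; rewrite ltnn.
  by rewrite normr_prod big1 // => i _; rewrite EmE.
rewrite !det_mulmx det_tr !normrM (gtr0_norm E_gt0) => h.
have nm : `|\det m| = (\det E) ^- 2.
  have E_neq0 : \det E != 0 by rewrite gt_eqF.
  apply: (mulfI E_neq0); apply: (mulIf E_neq0); rewrite h.
  by field.
by rewrite /dvol nm -exprVn sqrtr_sqr gtr0_norm ?invrK // invr_gt0.
Qed.

Let wedge22_base i j B :
  wedge22 (wedge (ebase i) (ebase j)) B = - wedge22 (wedge (ebase j) (ebase i)) B.
Proof. by rewrite /wedge22 !wedgeE; ring. Qed.

Lemma hodge_2vector m eta : is_2vector (hodge m eta).
Proof.
by apply/matrixP => i j; rewrite !mxE wedge22_base mulrN.
Qed.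

Let skewE A i j : is_2vector A -> A j i = - A i j.
Proof. by move=> /matrixP /(_ i j); rewrite !mxE. Qed.

Lemma hodgeP m xi eta : is_2vector xi -> is_2vector eta ->
  wedge22 xi (hodge m eta) = ip2 m xi eta * dvol m.
Proof.
move=> sxi seta; rewrite /ip2 /hodge.
set B := m *m eta *m m^T.
have sB : is_2vector B.
  by rewrite /is_2vector /B !trmx_mul trmxK seta mulNmx mulmxN mulmxA.
have d0 A i : is_2vector A -> A i i = 0.
  move=> sA; apply/eqP; have /eqP := skewE i i sA.
  by rewrite -addr_eq0 -mulr2n mulrn_eq0.
have BE i j : (hodge m eta) i j = dvol m * wedge22 (wedge (ebase i) (ebase j)) B.
  by rewrite mxE mxE.
rewrite -/(hodge m eta) /wedge22 !BE /wedge22; clearbody B.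
rewrite !wedgeE !mxE /=.
have -> : \tr (xi^T *m B) = \sum_i \sum_j xi i j * B i j.
  rewrite /mxtrace exchange_big /=; apply: eq_bigr => i _.
  by rewrite mxE; apply: eq_bigr => j _; rewrite mxE.
rewrite !sum4 !d0 // (skewE 0 1 sxi) (skewE 0 2 sxi) (skewE 0 3 sxi).
rewrite (skewE 1 2 sxi) (skewE 1 3 sxi) (skewE 2 3 sxi).
rewrite (skewE 0 1 sB) (skewE 0 2 sB) (skewE 0 3 sB).
rewrite (skewE 1 2 sB) (skewE 1 3 sB) (skewE 2 3 sB).
by field.
Qed.

Let bilin_wedge (F : 'rV[R]_4 -> 'rV[R]_4 -> R) v w :
    (forall y, linear (F^~ y)) -> (forall x, linear (F x)) ->
  \sum_i \sum_j wedge v w i j * F (ebase i) (ebase j) = F v w - F w v.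
Proof.
move=> Fl Fr.
have FE a b : F a b = \sum_i \sum_j (a 0 i * b 0 j) * F (ebase i) (ebase j).
  have Fsum (h : 'rV[R]_4 -> R) z : linear h ->
      h z = \sum_i z 0 i * h (ebase i).
    move=> hl; have h0 : h 0 = 0.
      by have := hl (-1) 0 0; rewrite scaler0 addr0 scaleN1r addNr.
    have hD a' b' : h (a' + b') = h a' + h b'.
      by have := hl 1 a' b'; rewrite !scale1r.
    rewrite {1}(row_sum_delta z) (big_morph h hD h0).
    by apply: eq_bigr => i _; have := hl (z 0 i) 'e_i 0; rewrite !addr0 h0 addr0.
  rewrite (Fsum (F^~ b)) //; apply: eq_bigr => i _.
  by rewrite (Fsum (F _)) // mulr_sumr; apply: eq_bigr => j _; rewrite mulrA.
rewrite !FE -sumrB; apply: eq_bigr => i _; rewrite -sumrB.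
by apply: eq_bigr => j _; rewrite wedgeE mulrBl.
Qed.

Lemma curv_opP G Rm :
    G \in unitmx -> G^T = G ->
    (forall w x y, linear (fun v => Rm v w x y)) ->
    (forall v x y, linear (fun w => Rm v w x y)) ->
    (forall v w y, linear (fun x => Rm v w x y)) ->
    (forall v w x, linear (Rm v w x)) ->
    (forall v w x y, Rm w v x y = - Rm v w x y) ->
    (forall v w x y, Rm v w y x = - Rm v w x y) ->
  forall v w x y,
    ip2 G (curv_op G Rm (wedge v w)) (wedge x y) = - Rm v w x y.
Proof.
move=> uG sG l1 l2 l3 l4 a12 a34 v w x y.
rewrite /ip2 /curv_op; set K := (\matrix_(k, l) _).
have -> : K = \matrix_(k, l) - Rm v w (ebase k) (ebase l).
  apply/matrixP => k l; rewrite !mxE.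
  rewrite (bilin_wedge (F := fun a b => Rm a b (ebase k) (ebase l))) //.
  by rewrite [Rm w v _ _]a12; field.
rewrite trmx_inv sG !trmx_mul trmx_inv sG -!mulmxA (mulKmx uG).
rewrite mxtrace_mulC -!mulmxA mulmxV // mulmx1.
transitivity (2^-1 * (- \sum_i \sum_j
    wedge x y i j * Rm v w (ebase i) (ebase j))); last first.
  by rewrite (bilin_wedge (F := Rm v w)) // [Rm v w y x]a34; field.
congr (_ * _); rewrite /mxtrace; under eq_bigr do rewrite mxE.
rewrite exchange_big /= -sumrN; apply: eq_bigr => k _.
rewrite -sumrN; apply: eq_bigr => l _; rewrite mxE [X in X * _]mxE.
by rewrite mulNr mulrC.
Qed.

Lemma wedge_plane v w u : wedge v w != 0 ->
  (u <= wedge v w)%MS <-> exists s t : R, u = s *: v + t *: w.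
Proof.
move=> vw0; split.
  move=> /submxP[D ->]; exists (- (D *m w^T) 0 0), ((D *m v^T) 0 0).
  rewrite /wedge mulmxBr !mulmxA [D *m v^T in LHS]mx11E.
  by rewrite [D *m w^T in LHS]mx11E !mul_scalar_mx addrC scaleNr.
have [i [j Aij]] : exists i j, wedge v w i j != 0.
  exact/matrix0Pn.
move=> [s [t ->]]; move: (wedgeE v w) Aij.
move: (wedge v w) => W WE Aij; have := Aij; rewrite WE => vw_neq0.
have vP : v = (W i j)^-1 *:
    (v 0 j *: row i W - v 0 i *: row j W).
  apply/rowP => k; rewrite !mxE !WE.
  by field.
have wP : w = (W i j)^-1 *:
    (w 0 j *: row i W - w 0 i *: row j W).
  apply/rowP => k; rewrite !mxE !WE.
  by field.
have sub a b c d : (a *: (b *: row i W - c *: row j W) : 'rV_4)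
    = d -> (d <= W)%MS.
  by move=> <-; rewrite scalemx_sub // addmx_sub ?eqmx_opp ?scalemx_sub ?row_sub.
by rewrite addmx_sub // scalemx_sub // (sub _ _ _ _ (esym vP), sub _ _ _ _ (esym wP)).
Qed.

End TwoVectorFacts.

Section Pointwise.
Context {R : realType} {M : oriented_manifold4 R}.
Variables (g : riemannian_metric M) (T : vector_field M).
Implicit Types (phi : chart R M) (p : M) (P xi : 'M[R]_4).

(* Components in phi of objects at p; meaningful for phi in the atlas and p in
   its domain. *)

Definition g_at phi p : 'M[R]_4 := g phi (phi p).
Definition T_at phi p : 'rV[R]_4 := T phi (phi p).

Definition gL_at phi p : 'M[R]_4 :=
  let Tflat := T_at phi p *m g_at phi p in
  g_at phi p - 2 *: (Tflat^T *m Tflat).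

Definition curvature_operator phi p : 'M[R]_4 -> 'M[R]_4 :=
  curv_op (g_at phi p) (riemann_at (g phi) (phi p)).

Definition hodge_L phi p : 'M[R]_4 -> 'M[R]_4 := hodge (gL_at phi p).

Definition unit_length : Prop := forall phi p, atlas phi -> cdom phi p ->
  ip (g_at phi p) (T_at phi p) (T_at phi p) = 1.

Definition star_L_Einstein : Prop := forall phi p, atlas phi -> cdom phi p ->
  forall xi, is_2vector xi ->
    curvature_operator phi p (hodge_L phi p xi) =
    hodge_L phi p (curvature_operator phi p xi).

(* Lambda^2_C: multiplication by the imaginary unit is hodge_L. *)
Definition cscale phi p (z : R[i]) xi : 'M[R]_4 :=
  complex.Re z *: xi + complex.Im z *: hodge_L phi p xi.

Definition complex_eigenvector phi p P : Prop :=
  [/\ is_2vector P, P != 0 &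
      exists z : R[i], curvature_operator phi p P = cscale phi p z P].

Definition G_plus phi p : set 'M[R]_4 :=
  [set P | decomposable P /\ ip2 (gL_at phi p) P P = 1].

Definition G_minus phi p : set 'M[R]_4 :=
  [set P | decomposable P /\ ip2 (gL_at phi p) P P = -1].

Definition grassmannian phi p : set 'M[R]_4 :=
  [set P | decomposable P /\ ip2 (g_at phi p) P P = 1].

Definition sec phi p P : R :=
  ip2 (g_at phi p) (curvature_operator phi p P) P.

(* The differential of sec on the Grassmannian vanishes at P; tangent vectors
   are velocities of smooth curves in the Grassmannian. *)
Definition sec_critical phi p P : Prop :=
  grassmannian phi p P /\
  forall gamma : R^o -> 'M[R]_4, smooth_on setT gamma ->
    (forall t, grassmannian phi p (gamma t)) -> gamma 0 = P ->
    is_derive (0 : R^o) (1 : R^o) (fun t => sec phi p (gamma t)) (0 : R^o).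

End Pointwise.

(* Main.v *)
Require Import Defs.
From mathcomp Require Import all_boot all_order all_algebra.
From mathcomp Require Import all_classical all_reals all_analysis.
From mathcomp Require Import complex ring.
Set Implicit Arguments.
Unset Strict Implicit.
Unset Printing Implicit Defensive.
Import Order.TTheory GRing.Theory Num.Theory.
Import numFieldNormedType.Exports.
Local Open Scope classical_set_scope.
Local Open Scope ring_scope.

(** Let A be the curvature operator and * the Hodge star of g.  Since A is
   self-adjoint, the differential of sec(P) = <A P, P> in the direction Q is
   2 <A P, Q>.  The Grassmannian of unit decomposable 2-vectors is cut out by
   <P, P> = 1 and P /\ P = 0, and P /\ Q is a multiple of <*P, Q>; so its tangent
   space at P is the orthogonal complement of P and *P, and P is critical if and
   only if A P lies in the span of P and *P ([sec_criticalP]).  One direction only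
   differentiates the two equations along a curve.  The other needs enough curves:
   rotations of P about one of its vectors, which are explicit in cos and sin.

   If P is orthogonal to T or contains T, the reflection that turns g into its
   Lorentzian companion g_L multiplies P by a sign ([lorentz_flip]).  Consequently
   *_L P is a nonzero multiple of *P, so the span of P and *P is the complex line of
   P for i = *_L: being critical means that A P is a complex multiple of P.
   The same sign shows that a P of g_L-norm 1 or -1 has g-norm 1.

   The self-adjointness of A and the skewness of its values are the symmetries of
   the Riemann tensor under exchange of its two pairs of arguments and of its last
   two arguments.  Both are read off the coordinate expression of
   g(nabla_a nabla_b e_c, e_d) ([ip_second_covd]) once the second derivatives of the
   metric coefficients are known to commute ([derive_comm]). *)

(** * Symmetry of second derivatives *)

Section Schwarz.
Context {R : realType} {V : normedModType R}.
Implicit Types (f : V -> R) (x y u v : V) (s : R).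

Lemma is_derive_shiftl f y u v :
  derivable f (v + y) u ->
  is_derive y u (fun z => f (v + z)) ('D_u f (v + y)).
Proof.
move=> fd; have E : (fun h : R => h^-1 *: (((fun z => f (v + z)) \o shift y) (h *: u)
    - f (v + y))) = (fun h => h^-1 *: ((f \o shift (v + y)) (h *: u) - f (v + y))).
  by apply/funext => h /=; rewrite addrCA.
by split; rewrite /derivable /derive E.
Qed.

(** Brings directional derivatives within reach of the one-variable mean value
   theorem. *)
Lemma is_derive_line f x v s :
  derivable f (s *: v + x) v ->
  is_derive s 1 (fun h : R => f (h *: v + x)) ('D_v f (s *: v + x)).
Proof.
move=> fd; have E : (fun h : R => h^-1 *: (((fun k : R => f (k *: v + x)) \o shift s)
    (h *: 1) - f (s *: v + x))) =
    (fun h => h^-1 *: ((f \o shift (s *: v + x)) (h *: v) - f (s *: v + x))).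
  by apply/funext => h /=; rewrite [h *: 1]mulr1 scalerDl addrA.
by split; rewrite /derivable /derive E.
Qed.

Lemma MVT_line f x v s : 0 < s ->
    (forall h, 0 <= h <= s -> derivable f (h *: v + x) v) ->
  exists2 c, 0 <= c <= s & f (s *: v + x) - f x = s * 'D_v f (c *: v + x).
Proof.
move=> s0 fd.
have fd' h : 0 <= h <= s ->
    is_derive h (1 : R) (fun h : R => f (h *: v + x)) ('D_v f (h *: v + x)).
  by move=> hs; apply: is_derive_line; exact: fd.
have [||c cs E] := @MVT R (fun h => f (h *: v + x)) (fun h => 'D_v f (h *: v + x)) 0 s s0.
- by move=> h; rewrite in_itv /= => /andP[h0 hs]; apply: fd'; rewrite !ltW.
- apply: derivable_within_continuous => h; rewrite in_itv /= => hs.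
  by have [] := fd' h hs.
exists c; first by move: cs; rewrite in_itv /= => /andP[? ?]; rewrite !ltW.
by move: E; rewrite scale0r add0r subr0 mulrC.
Qed.

(** Two applications of the mean value theorem: along [u] to the difference
   of [f] at two points that differ by [s *: v], then along [v] to ['D_u f]. *)
Lemma mixed_difference f x u v s : 0 < s ->
    (forall a b, 0 <= a <= s -> 0 <= b <= s ->
      derivable f (b *: v + (a *: u + x)) u /\
      derivable ('D_u f) (b *: v + (a *: u + x)) v) ->
  exists a b, [/\ 0 <= a <= s, 0 <= b <= s &
    f (s *: v + (s *: u + x)) - f (s *: u + x) - (f (s *: v + x) - f x) =
    s * s * 'D_v ('D_u f) (b *: v + (a *: u + x))].
Proof.
move=> s0 fd.
have ss : 0 <= s <= s by rewrite ltW /=.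
have zs : 0 <= (0 : R) <= s by rewrite lexx ltW.
pose d y := f (s *: v + y) - f y.
have dd a : 0 <= a <= s -> is_derive (a *: u + x) u d
    ('D_u f (s *: v + (a *: u + x)) - 'D_u f (a *: u + x)).
  move=> as_; apply: is_deriveB.
    by apply: is_derive_shiftl; have [] := fd a s as_ ss.
  apply: derivableP; have [+ _] := fd a 0 as_ zs.
  by rewrite scale0r add0r.
have [|a as_ E1] := @MVT_line d x u s s0.
  by move=> h /dd[].
have [|b bs E2] := @MVT_line ('D_u f) (a *: u + x) v s s0.
  by move=> h hs; have [] := fd a h as_ hs.
exists a, b; split=> //.
rewrite -[LHS]/(d (s *: u + x) - d x) E1; have [_ ->] := dd a as_.
by rewrite E2 mulrA.
Qed.

Lemma nbhs_parallelogram x u v (A : set V) : nbhs x A ->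
  exists2 s : R, 0 < s &
    forall a b, 0 <= a <= s -> 0 <= b <= s -> A (b *: v + (a *: u + x)).
Proof.
move=> /nbhs_ballP[e /= e0 eA].
pose k := `|u| + `|v| + 1.
have k0 : 0 < k by rewrite ltr_wpDl // addr_ge0.
exists (e / k / 2); first by rewrite !divr_gt0.
move=> a b /andP[a0 a1] /andP[b0 b1]; apply: eA.
rewrite -ball_normE /ball_ /= addrA opprD addrCA subrr addr0 normrN.
apply: (le_lt_trans (ler_normD _ _)); rewrite !normrZ !ger0_norm //.
have : b * `|v| + a * `|u| <= e / k / 2 * (`|v| + `|u|).
  by rewrite mulrDr lerD // ler_wpM2r.
move=> /le_lt_trans; apply.
apply: (@le_lt_trans _ _ (e / 2)); last by rewrite ltr_pdivrMr // ltr_pMr // ltr1n.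
rewrite -mulrA [_^-1 * _]mulrC !mulrA ler_pM2r // -mulrA -[leRHS]mulr1 ler_pM2l //.
by rewrite mulrC ler_pdivrMr // mul1r /k addrC ler_wpDr.
Qed.

(** The second-order difference of [f] over the parallelogram spanned by
   [s *: u] and [s *: v] is symmetric in [u] and [v], and equals [s * s] times
   either mixed derivative at some point of the parallelogram; both points tend
   to [x] with [s]. *)
Lemma derive_comm f x u v :
    (\forall y \near x, derivable f y u) ->
    (\forall y \near x, derivable f y v) ->
    (\forall y \near x, derivable ('D_u f) y v) ->
    (\forall y \near x, derivable ('D_v f) y u) ->
    {for x, continuous ('D_v ('D_u f))} ->
    {for x, continuous ('D_u ('D_v f))} ->
  'D_v ('D_u f) x = 'D_u ('D_v f) x.
Proof.
move=> fu fv fuv fvu cuv cvu.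
apply/eqP; rewrite -subr_eq0 -normr_le0; apply/ler_addgt0Pr => e e0.
rewrite add0r.
have e2 : 0 < e / 2 by rewrite divr_gt0.
move/cvgrPdist_le : cuv => /(_ _ e2) cuv.
move/cvgrPdist_le : cvu => /(_ _ e2) cvu.
have [s s0 sA] := nbhs_parallelogram u v
  (filterI (filterI (filterI fu fuv) (filterI fv fvu)) (filterI cuv cvu)).
have [|a [b [as_ bs E1]]] := @mixed_difference f x u v s s0.
  by move=> a b as_ bs; have [[[? ?] _] _] := sA a b as_ bs.
have [|b' [a' [bs' as' E2]]] := @mixed_difference f x v u s s0.
  by move=> b' a' bs' as'; have [[_ [? ?]] _] := sA a' b' as' bs'; rewrite addrCA.
have [_ [/= D1 _]] := sA a b as_ bs.
have [_ [/= _ D2]] := sA a' b' as' bs'.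
move: E2; rewrite [s *: u + _]addrCA [a' *: u + _]addrCA => E2.
have /mulfI E : s * s != 0 by rewrite mulf_neq0 // gt_eqF.
have {}E : 'D_v ('D_u f) (b *: v + (a *: u + x)) =
    'D_u ('D_v f) (b' *: v + (a' *: u + x)).
  by apply: E; rewrite -E1 -E2; ring.
rewrite (splitr e) -(subrKA ('D_v ('D_u f) (b *: v + (a *: u + x)))).
apply: (le_trans (ler_normD _ _)); apply: lerD; first exact: D1.
by rewrite E distrC.
Qed.

End Schwarz.

(** * Derivatives of matrix-valued functions *)

Section MatrixFunctions.
Context {R : realType} {V : normedModType R}.
Implicit Types (x y u v : V).

Lemma is_derive_bigsum (I : Type) (r : seq I) (F : I -> V -> R) (dF : I -> R) x v :
  (forall i, is_derive x v (F i) (dF i)) ->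
  is_derive x v (fun y => \sum_(i <- r) F i y) (\sum_(i <- r) dF i).
Proof.
move=> h; elim: r => [|i r IH].
  by rewrite big_nil; under eq_fun do rewrite big_nil; exact: is_derive_cst.
by rewrite big_cons; under eq_fun do rewrite big_cons; exact: is_deriveD.
Qed.

Lemma derivable_bigsum (I : Type) (r : seq I) (F : I -> V -> R) x v :
  (forall i, derivable (F i) x v) -> derivable (fun y => \sum_(i <- r) F i y) x v.
Proof.
move=> dF; have h i : is_derive x v (F i) ('D_v (F i) x) by exact: derivableP.
by have [] := is_derive_bigsum r h.
Qed.

Lemma derivable_bigprod (I : Type) (r : seq I) (F : I -> V -> R) x v :
  (forall i, derivable (F i) x v) -> derivable (fun y => \prod_(i <- r) F i y) x v.
Proof.
move=> dF; elim: r => [|i r IH].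
  by under eq_fun do rewrite big_nil; exact: derivable_cst.
by under eq_fun do rewrite big_cons; exact: derivableM.
Qed.

Lemma derivable_det n (F : V -> 'M[R]_n) x v :
  (forall i j, derivable (fun y => F y i j) x v) ->
  derivable (fun y => \det (F y)) x v.
Proof.
move=> dF; apply: derivable_bigsum => s; apply: derivableM; first exact: derivable_cst.
exact: derivable_bigprod.
Qed.

(** Cramer's rule makes the entries of the inverse rational functions of
   those of the matrix. *)
Lemma derivable_invmx n (F : V -> 'M[R]_n) x v :
    (\forall y \near x, F y \in unitmx) ->
    (forall i j, derivable (fun y => F y i j) x v) ->
  forall i j, derivable (fun y => invmx (F y) i j) x v.
Proof.
move=> uF dF i j.
apply: (@near_eq_derivable _ _ _
    (fun y => (\det (F y))^-1 * ((-1) ^+ (j + i) * \det (row' j (col' i (F y)))))).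
  by near=> y; rewrite /invmx ifT ?mxE //; near: y.
apply: derivableM.
  apply: derivableV; last exact: derivable_det.
  by have := nbhs_singleton uF; rewrite unitmxE unitfE.
apply: derivableM; first exact: derivable_cst.
apply: derivable_det => k l.
by under eq_fun do rewrite !mxE; exact: dF.
Unshelve. all: by end_near. Qed.

Lemma derive_mulmx_row n (F : V -> 'rV[R]_n) (H : V -> 'M[R]_n) x v j :
    derivable F x v -> derivable H x v ->
  'D_v (fun y => (F y *m H y) 0 j) x =
  ('D_v F x *m H x + F x *m 'D_v H x) 0 j.
Proof.
move=> dF dH; have dF' := (derivable_mxP _ _ _).1 dF; have dH' := (derivable_mxP _ _ _).1 dH.
have -> : (fun y => (F y *m H y) 0 j) =
    \sum_k ((fun y => F y 0 k) * (fun y => H y k j) : V -> R).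
  by apply/funext => y; rewrite fct_sumE mxE.
rewrite derive_sum; last by move=> k; exact: derivableM.
rewrite (derive_mx dF) (derive_mx dH) !mxE -big_split /=; apply: eq_bigr => k _.
by rewrite deriveM // !mxE addrC [H x k j *: _]mulrC.
Qed.

End MatrixFunctions.

Section MetricDerivatives.
Context {R : realType} {U : set 'rV[R]_4} {G : 'rV[R]_4 -> 'M[R]_4}.
Hypotheses (oU : open U) (smG : smooth_on U G).
Implicit Types (x y u v : 'rV[R]_4).

Lemma derivable_metric v y : U y -> derivable G y v.
Proof. by move=> Uy; have [/(_ _ Uy) /diff_derivable] := smG 1. Qed.

Lemma derivable_entry v y i j : U y -> derivable (fun z => G z i j) y v.
Proof. by move=> Uy; exact/(derivable_mxP _ _ _).1/derivable_metric. Qed.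

Let derive_entry v y i j : U y -> 'D_v (fun z => G z i j) y = 'D_v G y i j.
Proof. by move=> Uy; rewrite (derive_mx (derivable_metric Uy)) mxE. Qed.

Lemma derivable_derive_entry u v y i j : U y ->
  derivable ('D_u (fun z => G z i j)) y v.
Proof.
move=> Uy; apply: (@near_eq_derivable _ _ _ (fun z => 'D_u G z i j)).
  by near=> z; rewrite derive_entry //; near: z; exact: open_nbhs_nbhs.
have [_ /(_ u)[/(_ _ Uy) /diff_derivable dG _]] := smG 2.
exact/(derivable_mxP _ _ _).1/dG.
Unshelve. all: by end_near. Qed.

Let derive2_entry u v y i j : U y ->
  'D_v ('D_u (fun z => G z i j)) y = 'D_v ('D_u G) y i j.
Proof.
move=> Uy; rewrite (@near_eq_derive _ _ _ _ (fun z => 'D_u G z i j)).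
  have [_ /(_ u)[/(_ _ Uy) /diff_derivable dG _]] := smG 2.
  by rewrite (derive_mx (dG v)) mxE.
by near=> z; rewrite derive_entry //; near: z; exact: open_nbhs_nbhs.
Unshelve. all: by end_near. Qed.

Lemma derive_entry_comm u v y i j : U y ->
  'D_v ('D_u (fun z => G z i j)) y = 'D_u ('D_v (fun z => G z i j)) y.
Proof.
move=> Uy; have nU : nbhs y U by exact: open_nbhs_nbhs.
have cont u' v' : {for y, continuous ('D_v' ('D_u' (fun z => G z i j)))}.
  have [_ /(_ u')[_ /(_ v')/(_ _ Uy) cG]] := smG 2.
  rewrite /continuous_at /prop_for derive2_entry //.
  apply: (@cvg_trans _ (('D_v' ('D_u' G) z i j) @[z --> y])).
    have E : \forall z \near y, 'D_v' ('D_u' G) z i j =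
        'D_v' ('D_u' (fun z => G z i j)) z.
      by near=> z; rewrite derive2_entry //; near: z.
    exact: near_eq_cvg E.
  apply: (@continuous_comp _ _ _ ('D_v' ('D_u' G)) (fun N : 'M[R]_4 => N i j)).
    exact: cG.
  exact: coord_continuous.
have d1 w : \forall z \near y, derivable (fun z => G z i j) z w.
  by apply: filterS nU => z; apply: derivable_entry.
have d2 w w' : \forall z \near y, derivable ('D_w (fun z => G z i j)) z w'.
  by apply: filterS nU => z; apply: derivable_derive_entry.
exact: derive_comm.
Unshelve. all: by end_near. Qed.

End MetricDerivatives.

(** * Symmetries of the Riemann tensor *)

Section RiemannTensor.
Context {R : realType} {U : set 'rV[R]_4} {G : 'rV[R]_4 -> 'M[R]_4}.
Hypotheses (oU : open U) (smG : smooth_on U G).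
Hypothesis symG : forall y, U y -> (G y)^T = G y.
Hypothesis uG : forall y, U y -> G y \in unitmx.
Implicit Types (x y u v : 'rV[R]_4) (a b c d i j k l : 'I_4).

Local Notation dG v i j := ('D_(ebase v) (fun y => G y i j)).
Local Notation ddG u v i j := ('D_(ebase u) (dG v i j)).

Let nearU x : U x -> \forall y \near x, U y.
Proof. by move=> Ux; exact: open_nbhs_nbhs. Qed.

Let dG_sym x a i j : U x -> dG a i j x = dG a j i x.
Proof.
move=> Ux; apply: near_eq_derive; near=> y.
have Uy : U y by near: y; exact: nearU.
by rewrite -[in LHS](symG Uy) mxE.
Unshelve. all: by end_near. Qed.

Let ddG_sym x a b i j : U x -> ddG a b i j x = ddG a b j i x.
Proof.
move=> Ux; apply: near_eq_derive; near=> y.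
by apply: dG_sym; near: y; exact: nearU.
Unshelve. all: by end_near. Qed.

Let ddG_comm x a b i j : U x -> ddG a b i j x = ddG b a i j x.
Proof. by move=> Ux; exact: (derive_entry_comm oU smG). Qed.

Lemma christoffel1_sym x i j k : U x ->
  christoffel1 G x i j k = christoffel1 G x j i k.
Proof.
by move=> Ux; rewrite /christoffel1 (dG_sym k i j) // [X in _ * (X - _)]addrC.
Qed.

(** The metric is parallel, expressed by Christoffel symbols of the first kind. *)
Lemma metric_compatible x a k d : U x ->
  dG a k d x = christoffel1 G x a k d + christoffel1 G x a d k.
Proof.
by move=> Ux; rewrite /christoffel1 (dG_sym a d k) //; field.
Qed.

Lemma derivable_christoffel1 x v a b c : U x ->
  derivable (fun y => christoffel1 G y a b c) x v.
Proof.
move=> Ux; apply: derivableM; first exact: derivable_cst.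
by apply: derivableB; [apply: derivableD|]; exact: (derivable_derive_entry oU smG).
Qed.

Lemma derive_christoffel1 x d a b c : U x ->
  'D_(ebase d) (fun y => christoffel1 G y a b c) x =
  2^-1 * (ddG d a b c x + ddG d b a c x - ddG d c a b x).
Proof.
move=> Ux.
have d1 i j k w : derivable (dG i j k) x w.
  by exact: (derivable_derive_entry oU smG).
have dD := derivableD (d1 a b c (ebase d)) (d1 b a c (ebase d)).
transitivity ('D_(ebase d) (2^-1 \*o (dG a b c + dG b a c - dG c a b)) x) => //.
apply: (etrans (deriveMl _ (derivableB dD (d1 c a b (ebase d))))).
apply: (congr1 ( *%R _)); apply: (etrans (deriveB dD (d1 c a b (ebase d)))).
exact: (congr1 (fun t => t - _) (deriveD (d1 a b c (ebase d)) (d1 b a c (ebase d)))).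
Qed.

(** The vector field nabla_b e_c for coordinate fields. *)
Definition nabla_base b c y : 'rV[R]_4 :=
  (\row_k christoffel1 G y b c k) *m invmx (G y).

Lemma christoffel_base x a v :
  christoffel G x (ebase a) v =
  (\row_k \sum_j v 0 j * christoffel1 G x a j k) *m invmx (G x).
Proof.
congr (_ *m _); apply/rowP => k; rewrite !mxE (bigD1 a) //= [X in _ + X]big1 => [|i ia].
  by rewrite addr0; apply: eq_bigr => j _; rewrite mxE !eqxx mul1r.
by apply: big1 => j _; rewrite mxE (negbTE ia) andbF !mul0r.
Qed.

Lemma covd_base b c : covd G (cst (ebase b)) (cst (ebase c)) = nabla_base b c.
Proof.
apply/funext => y; rewrite /covd derive_cst add0r christoffel_base.
congr (_ *m _); apply/rowP => k; rewrite !mxE (bigD1 c) //= big1 => [|i ic].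
  by rewrite addr0 mxE !eqxx mul1r.
by rewrite mxE (negbTE ic) andbF mul0r.
Qed.

Lemma covd_bracket_base x a b c :
  covd G (lie_bracket (cst (ebase a)) (cst (ebase b))) (cst (ebase c)) x = 0.
Proof.
rewrite /covd derive_cst add0r /lie_bracket /= !derive_cst subrr /christoffel.
rewrite (_ : \row_k _ = 0) ?mul0mx //; apply/rowP => k; rewrite !mxE.
by apply: big1 => i _; apply: big1 => j _; rewrite mxE !mul0r.
Qed.

Lemma derivable_nabla_base x v b c : U x -> derivable (nabla_base b c) x v.
Proof.
move=> Ux; apply/derivable_mxP => i j; rewrite ord1.
under eq_fun do rewrite mxE; apply: derivable_bigsum => k.
apply: derivableM; first by under eq_fun do rewrite mxE; exact: derivable_christoffel1.
apply: derivable_invmx; last by move=> *; exact: (derivable_entry smG).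
by near=> y; apply: uG; near: y; exact: nearU.
Unshelve. all: by end_near. Qed.

Lemma nabla_baseK y b c : U y ->
  nabla_base b c y *m G y = \row_k christoffel1 G y b c k.
Proof. by move=> Uy; rewrite mulmxKV // uG. Qed.

(** g(nabla_i e_j, nabla_k e_l). *)
Let quad x i j k l : R :=
  (nabla_base i j x *m (\row_n christoffel1 G x k l n)^T) 0 0.

Let quad_sym x i j k l : U x -> quad x i j k l = quad x k l i j.
Proof.
move=> Ux; rewrite /quad /nabla_base -[in LHS](trmxK (_ *m _ *m _)) mxE.
by rewrite !trmx_mul !trmxK trmx_inv symG // mulmxA.
Qed.

Lemma ip_ebase (m : 'M[R]_4) v d : ip m v (ebase d) = (v *m m) 0 d.
Proof.
rewrite /ip mxE (bigD1 d) //= big1 => [|i id]; first by rewrite !mxE !eqxx mulr1 addr0.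
by rewrite !mxE (negbTE id) mulr0.
Qed.

(** g(nabla_a nabla_b e_c, e_d).  By the product rule, lowering the index of
   the derivative of nabla_b e_c produces a derivative of the metric, and
   [metric_compatible] cancels one summand of it against the Christoffel term of
   the outer covariant derivative. What remains are second derivatives of the
   metric and a product of two Christoffel symbols. *)
Lemma ip_second_covd x a b c d : U x ->
  ip (G x) (covd G (cst (ebase a)) (nabla_base b c) x) (ebase d) =
  2^-1 * (ddG a b c d x + ddG a c b d x - ddG a d b c x) - quad x b c a d.
Proof.
move=> Ux; rewrite ip_ebase /covd mulmxDl mxE christoffel_base mulmxKV ?uG //.
have dN : derivable (nabla_base b c) x (ebase a) by exact: derivable_nabla_base.
have dM : derivable G x (ebase a) by exact: (derivable_metric smG).
have : 'D_(ebase a) (fun y => (nabla_base b c y *m G y) 0 d) x =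
    2^-1 * (ddG a b c d x + ddG a c b d x - ddG a d b c x).
  rewrite -derive_christoffel1 //; apply: near_eq_derive; near=> y.
  by rewrite nabla_baseK ?mxE //; near: y; exact: nearU.
rewrite derive_mulmx_row // [X in X = _]mxE => /(canRL (addrK _)) ->.
rewrite /= -addrA; congr (_ + _).
rewrite /quad ![in LHS]mxE [in RHS]mxE -sumrN -sumrN -big_split /=; apply: eq_bigr => k _.
rewrite (derive_mx dM) !mxE metric_compatible //.
by ring.
Unshelve. all: by end_near. Qed.

(** [H a b c d] stands for the second derivative of the metric coefficient
   g_cd in the directions a and b, and [Q a b c d] for g(nabla_a e_b, nabla_c e_d).
   They are existentially quantified because the symmetries of the Riemann tensor
   follow from those of [H] and [Q] by algebra alone. *)
Lemma riemann_base x : U x ->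
  exists H Q : 'I_4 -> 'I_4 -> 'I_4 -> 'I_4 -> R,
  [/\ forall a b c d, H a b c d = H b a c d, forall a b c d, H a b c d = H a b d c,
      forall a b c d, Q a b c d = Q c d a b, forall a b c d, Q a b c d = Q b a d c &
      forall a b c d,
        riemann_at G x (ebase a) (ebase b) (ebase c) (ebase d) =
        2^-1 * (H a c b d - H a d b c - H b c a d + H b d a c)
        + Q a c b d - Q b c a d].
Proof.
move=> Ux; exists (fun a b c d => ddG a b c d x), (quad x); split.
- by move=> *; exact: ddG_comm.
- by move=> *; exact: ddG_sym.
- by move=> *; exact: quad_sym.
- have row_sym i j : \row_k christoffel1 G x i j k = \row_k christoffel1 G x j i k.
    by apply/rowP => k; rewrite !mxE christoffel1_sym.
  move=> a b c d.
  exact: (congr2 (fun u v : 'rV[R]_4 => (u *m invmx (G x) *m v^T) 0 0)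
    (row_sym a b) (row_sym c d)).
move=> a b c d.
have ipB u v : ip (G x) (u - v) (ebase d) = ip (G x) u (ebase d) - ip (G x) v (ebase d).
  by rewrite !ip_ebase mulmxBl !mxE.
transitivity (2^-1 * (ddG a b c d x + ddG a c b d x - ddG a d b c x) - quad x b c a d
    - (2^-1 * (ddG b a c d x + ddG b c a d x - ddG b d a c x) - quad x a c b d)).
  rewrite /riemann_at /riemann !covd_base covd_bracket_base subr0.
  by apply: (etrans (ipB _ _)); congr (_ - _); exact: ip_second_covd.
rewrite (ddG_comm a b c d Ux).
move: (quad x a c b d) (quad x b c a d) (ddG b a c d x) (ddG a c b d x) (ddG a d b c x).
move: (ddG b c a d x) (ddG b d a c x) => *; ring.
Qed.

Lemma riemann_base_skew x a b c d : U x ->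
  riemann_at G x (ebase a) (ebase b) (ebase d) (ebase c) =
  - riemann_at G x (ebase a) (ebase b) (ebase c) (ebase d).
Proof.
move=> /riemann_base[H [Q [_ _ Qsym _ E]]].
apply: (etrans (E a b d c)); apply: esym; apply: (etrans (congr1 -%R (E a b c d))).
by rewrite (Qsym a d b c) (Qsym b d a c); ring.
Qed.

Lemma riemann_base_pair x a b c d : U x ->
  riemann_at G x (ebase c) (ebase d) (ebase a) (ebase b) =
  riemann_at G x (ebase a) (ebase b) (ebase c) (ebase d).
Proof.
move=> /riemann_base[H [Q [Hcomm Hsym Qsym Qswap E]]].
apply: (etrans (E c d a b)); apply: esym; apply: (etrans (E a b c d)).
rewrite (Qswap c a d b) (Qswap d a c b) (Qsym a d b c).
rewrite (Hcomm c a d b) (Hcomm c b d a) (Hcomm d a c b) (Hcomm d b c a).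
by rewrite (Hsym a c d b) (Hsym b c d a) (Hsym a d c b) (Hsym b d c a); ring.
Qed.

End RiemannTensor.

(** * 2-vectors and the star of a coordinate space *)

Section LinearAlgebra.
Context {R : realType}.
Implicit Types (G m A B P Q X Y : 'M[R]_4) (u v w z T : 'rV[R]_4).

Lemma sum4 (V : zmodType) (F : 'I_4 -> V) : \sum_i F i = F 0 + F 1 + F 2 + F 3.
Proof.
rewrite !big_ord_recl big_ord0 addr0 !addrA.
by congr (_ + _ + _ + _); congr F; apply/val_inj.
Qed.

Lemma ord4P (Q : 'I_4 -> Prop) : Q 0 -> Q 1 -> Q 2 -> Q 3 -> forall i, Q i.
Proof.
move=> Q0 Q1 Q2 Q3 [[|[|[|[|i]]]] Hi] //.
- by rewrite (_ : Ordinal Hi = 0) //; exact/val_inj.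
- by rewrite (_ : Ordinal Hi = 1) //; exact/val_inj.
- by rewrite (_ : Ordinal Hi = 2) //; exact/val_inj.
- by rewrite (_ : Ordinal Hi = 3) //; exact/val_inj.
Qed.

Lemma wedgeE v w i j : wedge v w i j = v 0 i * w 0 j - w 0 i * v 0 j.
Proof. by rewrite !mxE !big_ord1 !mxE. Qed.

Lemma skewE X i j : is_2vector X -> X j i = - X i j.
Proof. by move=> /matrixP /(_ i j); rewrite !mxE. Qed.

Lemma skew_diag X i : is_2vector X -> X i i = 0.
Proof.
by move=> sX; apply/eqP; have /eqP := skewE i i sX; rewrite -addr_eq0 -mulr2n mulrn_eq0.
Qed.

Lemma congr_2vector X (F : 'M[R]_4) : is_2vector X -> is_2vector (F *m X *m F^T).
Proof. by move=> sX; rewrite /is_2vector !trmx_mul trmxK sX mulNmx mulmxN mulmxA. Qed.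

Lemma congr_wedge v w (F : 'M[R]_4) :
  F *m wedge v w *m F^T = wedge (v *m F^T) (w *m F^T).
Proof. by rewrite /wedge mulmxBr mulmxBl !trmx_mul !trmxK !mulmxA. Qed.

Lemma wedgeDl u v w : wedge (u + v) w = wedge u w + wedge v w.
Proof. by apply/matrixP => i j; rewrite !mxE !big_ord1 !mxE; ring. Qed.

Lemma wedgeDr u v w : wedge u (v + w) = wedge u v + wedge u w.
Proof. by apply/matrixP => i j; rewrite !mxE !big_ord1 !mxE; ring. Qed.

Lemma wedgeZl a v w : wedge (a *: v) w = a *: wedge v w.
Proof. by apply/matrixP => i j; rewrite !mxE !big_ord1 !mxE; ring. Qed.

Lemma wedgeZr a v w : wedge v (a *: w) = a *: wedge v w.
Proof. by apply/matrixP => i j; rewrite !mxE !big_ord1 !mxE; ring. Qed.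

Lemma wedgevv v : wedge v v = 0.
Proof. by rewrite /wedge subrr. Qed.

Lemma wedgeC v w : wedge w v = - wedge v w.
Proof. by rewrite /wedge opprB. Qed.

Lemma wedge22Dr X Y Z : wedge22 X (Y + Z) = wedge22 X Y + wedge22 X Z.
Proof. by rewrite /wedge22 !mxE; ring. Qed.

Lemma wedge22Zr a X Y : wedge22 X (a *: Y) = a * wedge22 X Y.
Proof. by rewrite /wedge22 !mxE; ring. Qed.

Lemma wedge22C X Y : wedge22 X Y = wedge22 Y X.
Proof. by rewrite /wedge22; ring. Qed.

Lemma wedge22_self v w : wedge22 (wedge v w) (wedge v w) = 0.
Proof. by rewrite /wedge22 !wedgeE; ring. Qed.

Definition base_wedge (i j : 'I_4) : 'M[R]_4 := wedge (ebase i) (ebase j).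

Lemma skew_expansion X : is_2vector X ->
  X = X 0 1 *: base_wedge 0 1 + X 0 2 *: base_wedge 0 2 + X 0 3 *: base_wedge 0 3
      + X 1 2 *: base_wedge 1 2 + X 1 3 *: base_wedge 1 3 + X 2 3 *: base_wedge 2 3.
Proof.
move=> sX; apply/matrixP; apply: ord4P; apply: ord4P;
  rewrite !mxE !big_ord1 !mxE /= ?skew_diag // ?[X 1 0]skewE ?[X 2 0]skewE
    ?[X 3 0]skewE ?[X 2 1]skewE ?[X 3 1]skewE ?[X 3 2]skewE //; ring.
Qed.

(** Both sides are linear in [Q], and on a decomposable [Q] they are
   determinants of four row vectors. *)
Lemma wedge22_congr (F : 'M[R]_4) v w Q : is_2vector Q ->
  wedge22 (F *m wedge v w *m F^T) (F *m Q *m F^T) = \det F * wedge22 (wedge v w) Q.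
Proof.
move=> sQ; pose L1 Y := wedge22 (F *m wedge v w *m F^T) (F *m Y *m F^T).
pose L2 Y := \det F * wedge22 (wedge v w) Y.
rewrite -/(L1 Q) -/(L2 Q).
have L1D X Y : L1 (X + Y) = L1 X + L1 Y by rewrite /L1 -wedge22Dr -mulmxDl -mulmxDr.
have L2D X Y : L2 (X + Y) = L2 X + L2 Y by rewrite /L2 wedge22Dr mulrDr.
have L1Z a X : L1 (a *: X) = a * L1 X by rewrite /L1 -wedge22Zr scalemxAl scalemxAr.
have L2Z a X : L2 (a *: X) = a * L2 X by rewrite /L2 wedge22Zr mulrCA.
have L12 i j : L1 (base_wedge i j) = L2 (base_wedge i j).
  rewrite /L1 /L2 /base_wedge !congr_wedge !wedge22_wedge -(det_tr F) mulrC -det_mulmx.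
  congr (\det _); apply/row_matrixP => k; rewrite row_mul !rowK.
  by move: k; apply: ord4P.
(* Abstracting the base prevents the additivity rules from splitting a wedge. *)
rewrite (skew_expansion sQ); move: base_wedge L12 => W L12.
by rewrite !(L1D, L2D, L1Z, L2Z) !L12.
Qed.

(** The Hodge star without its metric factors:
   [hodge m eta = dvol m *: star (m *m eta *m m^T)].  It depends on the
   coordinates only through the volume form, so it serves for g and for the
   Lorentzian metric alike. *)
Definition star (B : 'M[R]_4) : 'M[R]_4 :=
  \matrix_(i, j) wedge22 (wedge (ebase i) (ebase j)) B.

Lemma star_2vector B : is_2vector (star B).
Proof.
by apply/matrixP => i j; rewrite !mxE /wedge22 !wedgeE; ring.
Qed.

Lemma starE B :
  [/\ star B 0 1 = B 2 3, star B 0 2 = - B 1 3 & star B 0 3 = B 1 2] /\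
  [/\ star B 1 2 = B 0 3, star B 1 3 = - B 0 2 & star B 2 3 = B 0 1].
Proof. by do 2!split; rewrite mxE /wedge22 !wedgeE !mxE /=; ring. Qed.

Lemma star_eq0 B : is_2vector B -> star B = 0 -> B = 0.
Proof.
move=> sB B0; have := starE B; rewrite B0 !mxE => -[[E1 E2 E3] [E4 E5 E6]].
rewrite (skew_expansion sB) -E1 -E3 -E4 -E6.
move/esym/eqP: E2; rewrite oppr_eq0 => /eqP ->.
move/esym/eqP: E5; rewrite oppr_eq0 => /eqP ->.
by rewrite !scale0r !addr0.
Qed.

(** The star of a plane lives on the complementary plane. *)
Lemma star_wedge_mul v w : star (wedge v w) *m v^T = 0.
Proof.
by apply/colP; apply: ord4P; rewrite !mxE sum4 !mxE /wedge22 !wedgeE !mxE /=; ring.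
Qed.

Lemma starN B : star (- B) = - star B.
Proof. by apply/matrixP => i j; rewrite !mxE /wedge22 !mxE; ring. Qed.

Lemma starZ a B : star (a *: B) = a *: star B.
Proof. by apply/matrixP => i j; rewrite !mxE /wedge22 !mxE; ring. Qed.

Lemma wedge22_star A B : is_2vector A -> is_2vector B ->
  2^-1 * \tr ((star A)^T *m B) = wedge22 A B.
Proof.
move=> sA sB; have -> : \tr ((star A)^T *m B) = \sum_i \sum_j star A i j * B i j.
  rewrite /mxtrace exchange_big /=; apply: eq_bigr => i _.
  by rewrite mxE; apply: eq_bigr => j _; rewrite mxE.
have sS := star_2vector A; have [[E1 E2 E3] [E4 E5 E6]] := starE A.
rewrite !sum4 !skew_diag // (skewE 0 1 sS) (skewE 0 2 sS) (skewE 0 3 sS).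
rewrite (skewE 1 2 sS) (skewE 1 3 sS) (skewE 2 3 sS).
rewrite (skewE 0 1 sB) (skewE 0 2 sB) (skewE 0 3 sB).
rewrite (skewE 1 2 sB) (skewE 1 3 sB) (skewE 2 3 sB).
rewrite E1 E2 E3 E4 E5 E6 /wedge22.
by field.
Qed.

End LinearAlgebra.

(** * Orthonormal frames and the Lorentzian reflection *)

Section InnerProduct.
Context {R : realType} {G : 'M[R]_4}.
Hypothesis symG : G^T = G.
Hypothesis posG : forall v, v != 0 -> 0 < ip G v v.
Implicit Types (A B P Q X Y S : 'M[R]_4) (u v w z T : 'rV[R]_4).

Lemma ipC u v : ip G u v = ip G v u.
Proof. by rewrite /ip -[in LHS](trmxK (u *m G *m v^T)) mxE !trmx_mul trmxK symG mulmxA. Qed.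

Lemma ipDl u v w : ip G (u + v) w = ip G u w + ip G v w.
Proof. by rewrite /ip !mulmxDl mxE. Qed.

Lemma ipZl a u v : ip G (a *: u) v = a * ip G u v.
Proof. by rewrite /ip -!scalemxAl mxE. Qed.

Lemma ipDr u v w : ip G u (v + w) = ip G u v + ip G u w.
Proof. by rewrite ipC ipDl !(ipC u). Qed.

Lemma ipZr a u v : ip G u (a *: v) = a * ip G u v.
Proof. by rewrite ipC ipZl (ipC u). Qed.

Lemma metric_unit : G \in unitmx.
Proof.
rewrite -row_free_unit; apply: inj_row_free => v vG0.
apply/eqP; apply: contraT => /posG.
by rewrite /ip vG0 mul0mx mxE ltxx.
Qed.

Lemma ip2C X Y : ip2 G X Y = ip2 G Y X.
Proof.
rewrite /ip2; congr (_ * _).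
by rewrite -[in LHS]mxtrace_tr !trmx_mul !trmxK symG -!mulmxA
  mxtrace_mulC !mulmxA mxtrace_mulC !mulmxA.
Qed.

Lemma ip2Dl X Y Z : ip2 G (X + Y) Z = ip2 G X Z + ip2 G Y Z.
Proof. by rewrite /ip2 linearD /= mulmxDl mxtraceD mulrDr. Qed.

Lemma ip2Zl a X Y : ip2 G (a *: X) Y = a * ip2 G X Y.
Proof. by rewrite /ip2 linearZ /= -scalemxAl mxtraceZ mulrCA. Qed.

Lemma ip2_skew_wedge X v w : is_2vector X ->
  ip2 G X (wedge v w) = (v *m G *m X *m G *m w^T) 0 0.
Proof.
move=> sX; rewrite /ip2 sX /wedge symG mulmxBr mulmxBl mulmxBr raddfB /=.
have trE (a b : 'rV[R]_4) :
    \tr (- X *m (G *m (a^T *m b) *m G)) = - (b *m G *m X *m G *m a^T) 0 0 :> R.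
  rewrite mulNmx raddfN /=; congr (- _); rewrite !mulmxA mxtrace_mulC !mulmxA.
  rewrite mxtrace_mulC !mulmxA.
  by rewrite [in LHS](mx11_scalar (b *m _ *m _ *m _ *m _)) mxtrace_scalar.
rewrite !trE.
have -> : (w *m G *m X *m G *m v^T) 0 0 = - (v *m G *m X *m G *m w^T) 0 0.
  rewrite -[in LHS](trmxK (w *m _ *m _ *m _ *m _)) mxE !trmx_mul trmxK symG sX.
  by rewrite mulNmx !mulmxN mxE !mulmxA.
by field.
Qed.

(** The Cauchy-Schwarz inequality. *)
Lemma ip2_wedge_ge0 v w : 0 <= ip2 G (wedge v w) (wedge v w).
Proof.
rewrite ip2_wedge (ipC w v); have [->|v0] := eqVneq v 0.
  by rewrite /ip !mul0mx mxE !mul0r subrr.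
have vv := posG v0; pose c := ip G v w / ip G v v.
have ge0 : 0 <= ip G (w - c *: v) (w - c *: v).
  by have [->|/posG /ltW //] := eqVneq (w - c *: v) 0; rewrite /ip !mul0mx mxE.
rewrite -scaleNr !(ipDl, ipDr, ipZl, ipZr) (ipC w v) in ge0.
have -> : ip G v v * ip G w w - ip G v w * ip G v w =
    ip G v v * (ip G w w + - c * ip G v w + (- c * ip G v w + - c * (- c * ip G v v))).
  by rewrite /c; field; rewrite gt_eqF.
by rewrite mulr_ge0 // ltW.
Qed.

Lemma normalized v : v != 0 ->
  exists2 a, a != 0 & ip G (a *: v) (a *: v) = 1.
Proof.
move=> /posG vv; exists (Num.sqrt (ip G v v))^-1.
  by rewrite invr_neq0 // gt_eqF // sqrtr_gt0.
by rewrite ipZl ipZr mulrA -invfM -expr2 sqr_sqrtr ?mulVf ?gt_eqF // ltW.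
Qed.

(** A 4 x 3 matrix has a nonzero left kernel. *)
Lemma exists_unit_orthogonal u v w :
  exists z, [/\ ip G z z = 1, ip G u z = 0, ip G v z = 0 & ip G w z = 0].
Proof.
pose V : 'M[R]_(3, 4) := \matrix_(i < 3) [:: u; v; w]`_i.
have : kermx (G *m V^T) != 0.
  rewrite kermx_eq0 /row_free; apply/eqP => r4.
  by have := rank_leq_col (G *m V^T); rewrite r4.
case/rowV0Pn => z /sub_kermxP zV z0.
have [a a0 az] := normalized z0; exists (a *: z).
have ip0 i : ip G (row i V) z = 0.
  transitivity ((z *m (G *m V^T)) 0 i); last by rewrite zV mxE.
  by rewrite ipC /ip mulmxA mxE [RHS]mxE; apply: eq_bigr => k _; rewrite !mxE.
have := ip0 0; have := ip0 1; have := ip0 2; rewrite !rowK /= => w0 v0_ u0.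
by split; rewrite // ipZr ?w0 ?v0_ ?u0 mulr0.
Qed.

(** Gram-Schmidt in the plane; the factors [a] and [a^-1] keep the wedge
   unchanged, and the second vector then has length 1 because the area is 1. *)
Lemma unit_wedge_orthonormal v w : ip2 G (wedge v w) (wedge v w) = 1 ->
  exists v1 w1, [/\ wedge v w = wedge v1 w1, ip G v1 v1 = 1, ip G w1 w1 = 1 &
    ip G v1 w1 = 0].
Proof.
move=> vw1; have v0 : v != 0.
  apply/eqP => v0; move: vw1; rewrite ip2_wedge v0 /ip !mul0mx mxE !mul0r subrr.
  by move/eqP; rewrite eq_sym oner_eq0.
have vv := posG v0; have [a a0 av] := normalized v0.
pose c := ip G v w / ip G v v; exists (a *: v), (a^-1 *: (w - c *: v)).
have vc : ip G v (w - c *: v) = 0.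
  by rewrite -scaleNr ipDr ipZr /c; field; rewrite gt_eqF.
have wE : wedge v w = wedge (a *: v) (a^-1 *: (w - c *: v)).
  rewrite wedgeZl wedgeZr scalerA mulfV // scale1r -scaleNr wedgeDr wedgeZr wedgevv.
  by rewrite scaler0 addr0.
have vw0 : ip G (a *: v) (a^-1 *: (w - c *: v)) = 0 by rewrite ipZl ipZr vc !mulr0.
by split=> //; move: vw1; rewrite wE ip2_wedge av mul1r vw0 mul0r subr0.
Qed.

Lemma orthonormal_frame v w :
    ip G v v = 1 -> ip G w w = 1 -> ip G v w = 0 ->
  exists E : 'M[R]_4, [/\ E *m G *m E^T = 1%:M, row 0 E = v & row 1 E = w].
Proof.
move=> vv ww vw; have [e [ee ve we _]] := exists_unit_orthogonal v w v.
have [f [ff vf wf ef]] := exists_unit_orthogonal v w e.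
exists (\matrix_i [:: v; w; e; f]`_i); split; rewrite ?rowK //.
apply/matrixP => i j; transitivity (ip G [:: v; w; e; f]`_i [:: v; w; e; f]`_j).
  rewrite /ip mxE [RHS]mxE; apply: eq_bigr => k _.
  by rewrite -(rowK (fun i => [:: v; w; e; f]`_i)) -row_mul !mxE.
by move: i j; apply: ord4P; apply: ord4P; rewrite /= mxE /= // ipC.
Qed.

End InnerProduct.

Section LorentzFlip.
Context {R : realType} {G : 'M[R]_4} {T : 'rV[R]_4}.
Hypothesis symG : G^T = G.
Hypothesis uG : G \in unitmx.
Hypothesis unitT : ip G T T = 1.
Implicit Types (P : 'M[R]_4) (u v w : 'rV[R]_4).

Let Tb := T *m G.
Let gL := G - 2 *: (Tb^T *m Tb).
(* The reflection T |-> - T, in the form that acts on covectors. *)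
Let N : 'M[R]_4 := 1%:M - 2 *: (Tb^T *m T).

Let gLE : gL = N *m G.
Proof. by rewrite /gL /N mulmxBl mul1mx -scalemxAl -mulmxA. Qed.

Let TTb : T *m Tb^T = 1%:M.
Proof. by rewrite trmx_mul symG mulmxA [LHS]mx11_scalar -/(ip G T T) unitT. Qed.

Let NK : N *m N = 1%:M.
Proof.
have : (Tb^T *m T) *m (Tb^T *m T) = Tb^T *m T by rewrite mulmxA -(mulmxA Tb^T) TTb mulmx1.
rewrite /N; move: (Tb^T *m T) => A AA.
rewrite mulmxBl mul1mx mulmxBr mulmx1 -!scalemxAl -!scalemxAr AA.
by apply/matrixP => i j; rewrite !mxE; ring.
Qed.

Let NtE : N^T = 1%:M - 2 *: (T^T *m Tb).
Proof. by rewrite /N linearB /= trmx1 linearZ /= trmx_mul trmxK. Qed.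

Lemma lorentz_unit : gL \in unitmx.
Proof.
rewrite gLE unitmx_mul uG andbT; have [] := mulmx1_unit NK; by [].
Qed.

Lemma lorentz_dvol_neq0 : dvol gL != 0.
Proof.
have : \det gL != 0 by rewrite -unitfE -unitmxE lorentz_unit.
by move=> d0; rewrite /dvol invr_neq0 // gt_eqF // sqrtr_gt0 normr_gt0.
Qed.

Let gL_congr P : gL *m P *m gL^T = N *m (G *m P *m G) *m N^T.
Proof. by rewrite gLE trmx_mul symG !mulmxA. Qed.

(** The Lorentzian metric is g precomposed with the reflection in the
   orthogonal complement of [T].  On 2-vectors this reflection fixes the planes
   orthogonal to [T] and reverses the planes that contain [T]; hence lowering the
   indices of [P] by either metric gives the same result up to sign. *)
Lemma lorentz_flip P : decomposable P -> P != 0 ->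
    plane_orthogonal G T P \/ plane_contains T P ->
  exists2 e, e * e = 1 & gL *m P *m gL^T = e *: (G *m P *m G).
Proof.
move=> [v [w ->]] P0 [PT|].
  exists 1; first by rewrite mul1r.
  rewrite scale1r gL_congr.
  have PGT : wedge v w *m G *m T^T = 0.
    apply/row_matrixP => i; rewrite !row_mul row0 [LHS]mx11_scalar.
    have := PT (row i (wedge v w)) (row_sub _ _); rewrite /ip => ->.
    by apply/matrixP => k l; rewrite !mxE mul0rn.
  have NT : G *m wedge v w *m G *m N^T = G *m wedge v w *m G.
    rewrite NtE mulmxBr mulmx1 -scalemxAr.
    rewrite [X in _ *: X](_ : _ = G *m (wedge v w *m G *m T^T) *m Tb).
      by rewrite PGT mulmx0 mul0mx scaler0 subr0.
    by rewrite !mulmxA.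
  have sP : is_2vector (G *m wedge v w *m G).
    by have := congr_2vector G (wedge_2vector v w); rewrite symG.
  rewrite -mulmxA NT; apply: trmx_inj.
  by rewrite trmx_mul sP mulNmx NT.
move/(wedge_plane _ P0) => [s [t TE]].
(* [T] can be taken as one of the two vectors that span the plane. *)
have [w' wE] : exists w', wedge v w = wedge T w'.
  have [s0|s0] := eqVneq s 0; last first.
    exists (s^-1 *: w); rewrite TE wedgeZr wedgeDl !wedgeZl wedgevv scaler0 addr0.
    by rewrite scalerA mulVf // scale1r.
  have t0 : t != 0.
    apply/eqP => t0; move: unitT; rewrite TE s0 t0 !scale0r addr0 /ip !mul0mx mxE.
    by move/eqP; rewrite eq_sym oner_eq0.
  exists (- t^-1 *: v); rewrite TE s0 scale0r add0r wedgeZr wedgeZl scaleNr scalerA.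
  by rewrite mulVf // scale1r -wedgeC.
exists (-1); first by rewrite mulrNN mulr1.
have GP := congr_wedge T w' G; rewrite symG in GP.
rewrite gL_congr wE GP congr_wedge.
have TN : T *m G *m N^T = - (T *m G).
  rewrite -/Tb NtE mulmxBr mulmx1 -scalemxAr mulmxA.
  have -> : Tb *m T^T = 1%:M by rewrite -TTb trmx_mul symG mulmxA.
  by rewrite mul1mx; apply/rowP => i; rewrite !mxE; ring.
have wN : w' *m G *m N^T = w' *m G + (- 2 * ip G w' T) *: (T *m G).
  rewrite NtE mulmxBr mulmx1 -scalemxAr.
  rewrite mulmxA (mx11_scalar (w' *m G *m T^T)) -/(ip G w' T) mul_scalar_mx scalerA.
  by rewrite -scaleNr mulNr.
rewrite TN wN wedgeDr wedgeZr -scaleN1r !wedgeZl wedgevv !scaler0 addr0.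
by [].
Qed.

End LorentzFlip.

(** * The curvature operator and expansions in a frame *)

Section CurvatureOperator.
Context {R : realType} {G : 'M[R]_4}.
Variable Rm : 'rV[R]_4 -> 'rV[R]_4 -> 'rV[R]_4 -> 'rV[R]_4 -> R.
Hypothesis symG : G^T = G.
Hypothesis uG : G \in unitmx.
Implicit Types (X Y : 'M[R]_4).

Local Notation Rb i j k l := (Rm (ebase i) (ebase j) (ebase k) (ebase l)).

Let K X : 'M[R]_4 := \matrix_(k, l) - (2^-1 * \sum_i \sum_j X i j * Rb i j k l).

Let curv_opE X : curv_op G Rm X = invmx G *m K X *m (invmx G)^T.
Proof. by []. Qed.

Lemma curv_opD X Y : curv_op G Rm (X + Y) = curv_op G Rm X + curv_op G Rm Y.
Proof.
rewrite !curv_opE -mulmxDl -mulmxDr; congr (_ *m _ *m _).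
apply/matrixP => k l; rewrite !mxE -opprD -mulrDr -big_split /=; congr (- (_ * _)).
by apply: eq_bigr => i _; rewrite -big_split; apply: eq_bigr => j _; rewrite mxE mulrDl.
Qed.

Lemma curv_opZ a X : curv_op G Rm (a *: X) = a *: curv_op G Rm X.
Proof.
rewrite !curv_opE scalemxAl scalemxAr; congr (_ *m _ *m _).
apply/matrixP => k l; rewrite !mxE [RHS]mulrN [a * _]mulrCA [a * _]mulr_sumr.
congr (- (_ * _)).
apply: eq_bigr => i _; rewrite mulr_sumr; apply: eq_bigr => j _.
by rewrite mxE mulrA.
Qed.

Lemma curv_op_2vector X :
  (forall i j k l, Rb i j l k = - Rb i j k l) -> is_2vector (curv_op G Rm X).
Proof.
move=> skewR; rewrite curv_opE; apply: congr_2vector.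
apply/matrixP => k l; rewrite !mxE opprK -mulrN -sumrN; congr (_ * _).
apply: eq_bigr => i _; rewrite -sumrN; apply: eq_bigr => j _.
by rewrite skewR mulrN opprK.
Qed.

Let ip2_curv_op X Y :
  ip2 G (curv_op G Rm X) Y =
  - (2^-1 * (2^-1 * \sum_i \sum_j \sum_k \sum_l X i j * Y k l * Rb i j k l)).
Proof.
rewrite /ip2 curv_opE !trmx_mul !trmxK trmx_inv symG.
have -> : \tr (invmx G *m ((K X)^T *m invmx G) *m (G *m Y *m G)) = \tr ((K X)^T *m Y).
  rewrite !mulmxA mulmxKV // mxtrace_mulC !mulmxA mulmxV // mul1mx.
  by [].
rewrite -mulrN; congr (_ * _).
have -> : \tr ((K X)^T *m Y) = \sum_k \sum_l K X k l * Y k l.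
  rewrite /mxtrace exchange_big /=; apply: eq_bigr => k _.
  by rewrite mxE; apply: eq_bigr => l _; rewrite mxE.
transitivity (- (2^-1 * \sum_k \sum_l \sum_i \sum_j X i j * Y k l * Rb i j k l)).
  rewrite mulr_sumr -sumrN; apply: eq_bigr => k _.
  rewrite mulr_sumr -sumrN; apply: eq_bigr => l _; rewrite mxE mulNr -mulrA.
  congr (- (_ * _)); rewrite mulr_suml; apply: eq_bigr => i _.
  by rewrite mulr_suml; apply: eq_bigr => j _; rewrite mulrAC.
congr (- (_ * _)); under eq_bigr do rewrite exchange_big.
rewrite exchange_big; apply: eq_bigr => i _ /=.
under eq_bigr do rewrite exchange_big.
by rewrite exchange_big.
Qed.

(** Both sides are sums over all indices of [X i j * Y k l] times components of
   the curvature tensor; the pair symmetry exchanges the roles of [X] and [Y]. *)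
Lemma curv_op_selfadjoint X Y :
  (forall i j k l, Rb k l i j = Rb i j k l) ->
  ip2 G (curv_op G Rm X) Y = ip2 G (curv_op G Rm Y) X.
Proof.
move=> pairR; rewrite !ip2_curv_op; congr (- (_ * (_ * _))).
under eq_bigr do rewrite exchange_big; rewrite exchange_big.
apply: eq_bigr => k _ /=; under eq_bigr do rewrite exchange_big; rewrite exchange_big.
apply: eq_bigr => l _ /=; apply: eq_bigr => i _; apply: eq_bigr => j _.
by rewrite pairR (mulrC (X i j)).
Qed.

End CurvatureOperator.

Section Frames.
Context {R : realType} {G : 'M[R]_4}.
Hypothesis symG : G^T = G.
Hypothesis uG : G \in unitmx.
Implicit Types (E P Q X : 'M[R]_4) (v w : 'rV[R]_4).

(** The inner product of the star of [P] with [Q] is, up to the factor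
   [\det G], the coefficient of P /\ Q. *)
Lemma star_orthogonal v w Q : is_2vector Q -> wedge22 (wedge v w) Q = 0 ->
  ip2 G (star (G *m wedge v w *m G)) Q = 0.
Proof.
move=> sQ vwQ; have sGP := congr_2vector G (wedge_2vector v w).
have sGQ := congr_2vector G sQ.
rewrite /ip2 -[X in star (_ *m X)]symG wedge22_star //.
by rewrite wedge22_congr // vwQ mulr0.
Qed.

Lemma block_2vector X : is_2vector X ->
    X 0 2 = 0 -> X 0 3 = 0 -> X 1 2 = 0 -> X 1 3 = 0 ->
  X = X 0 1 *: base_wedge 0 1 + X 2 3 *: base_wedge 2 3.
Proof.
move=> sX X02 X03 X12 X13; rewrite {1}(skew_expansion sX) X02 X03 X12 X13.
by rewrite !scale0r !addr0.
Qed.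

(** In the frame [E] the hypothesis leaves only the components of [X] on
   e_0 /\ e_1 and e_2 /\ e_3.  The star of [P = e_0 /\ e_1] annihilates e_0 and e_1,
   so it is a multiple of e_2 /\ e_3, and it is nonzero since [P] is; therefore it can
   replace e_2 /\ e_3. *)
Lemma frame_expansion E X : E *m G *m E^T = 1%:M -> is_2vector X ->
    (forall i j : 'I_4, (i < 2)%N -> (2 <= j)%N ->
      ip2 G X (wedge (row i E) (row j E)) = 0) ->
  let P := wedge (row 0 E) (row 1 E) in
  exists a b, X = a *: P + b *: star (G *m P *m G).
Proof.
move=> EGE sX X0 P.
(* [F] computes the components of a 2-vector in the frame, and [E] restores it. *)
have [F FE] : exists F, F = E *m G by exists (E *m G).
have rowF i : row i F = row i E *m G by rewrite FE row_mul.
have FEt : F *m E^T = 1%:M by rewrite FE.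
have EtF : E^T *m F = 1%:M by exact: mulmx1C.
have FtE : F^T *m E = 1%:M by rewrite -[LHS]trmxK trmx_mul trmxK EtF trmx1.
have EFt : E *m F^T = 1%:M by exact: mulmx1C.
have back Z : Z = E^T *m (F *m Z *m F^T) *m E.
  by rewrite !mulmxA EtF mul1mx -mulmxA FtE mulmx1.
have P_back : P = E^T *m base_wedge 0 1 *m E.
  by have := congr_wedge (ebase 0) (ebase 1) E^T; rewrite trmxK -!rowE => ->.
have X'0 (i j : 'I_4) : (i < 2)%N -> (2 <= j)%N -> (F *m X *m F^T) i j = 0.
  move=> i2 j2; rewrite -(X0 i j i2 j2) ip2_skew_wedge // -rowF -[_ *m G *m _]mulmxA -row_mul.
  have -> : G *m (row j E)^T = (row j F)^T by rewrite rowF trmx_mul symG.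
  by rewrite mxE [RHS]mxE; apply: eq_bigr => k _; rewrite !mxE.
have := block_2vector (congr_2vector F sX)
  (X'0 0 2 isT isT) (X'0 0 3 isT isT) (X'0 1 2 isT isT) (X'0 1 3 isT isT).
move: ((F *m X *m F^T) 0 1) ((F *m X *m F^T) 2 3) => x y X'_block.
have GPG : G *m P *m G = wedge (row 0 F) (row 1 F).
  by have := congr_wedge (row 0 E) (row 1 E) G; rewrite symG -!rowF.
pose S := star (G *m P *m G).
have S'E (i j : 'I_4) : (j < 2)%N -> (F *m S *m F^T) i j = 0.
  move=> j2; have -> : (F *m S *m F^T) i j = (F *m (S *m (row j F)^T)) i 0.
    by rewrite mulmxA mxE [RHS]mxE; apply: eq_bigr => k _; rewrite !mxE.
  suff -> : S *m (row j F)^T = 0 by rewrite mulmx0 mxE.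
  rewrite /S GPG; case: (eqVneq j 0) => [->|j0]; first exact: star_wedge_mul.
  have -> : j = 1 by apply/val_inj; move: j j2 j0 => [[|[|]]].
  by rewrite wedgeC starN mulNmx star_wedge_mul oppr0.
have sS' := congr_2vector F (star_2vector (G *m P *m G)); rewrite -/S in sS'.
have S'_block : F *m S *m F^T = (F *m S *m F^T) 2 3 *: base_wedge 2 3.
  have S'E' (i j : 'I_4) : (j < 2)%N -> (F *m S *m F^T) j i = 0.
    by move=> j2; rewrite (skewE _ _ sS') S'E // oppr0.
  rewrite {1}(block_2vector sS' (S'E' 2 0 isT) (S'E' 3 0 isT) (S'E' 2 1 isT)
    (S'E' 3 1 isT)).
  by rewrite (S'E 0 1 isT) scale0r add0r.
move: S'_block; set s := (F *m S *m F^T) 2 3 => S'_block.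
have s0 : s != 0.
  apply/eqP => s0; have S0 : S = 0.
    by rewrite (back S) S'_block s0 scale0r mulmx0 mul0mx.
  have GPG0 : G *m P *m G = 0.
    by apply: star_eq0 => //; rewrite GPG; exact: wedge_2vector.
  have P0 : P = 0.
    have := congr1 (fun Z => invmx G *m Z *m invmx G) GPG0.
    by rewrite mulmx0 mul0mx -mulmxA mulmxK // mulKmx.
  have : F *m P *m F^T = base_wedge 0 1.
    by rewrite P_back !mulmxA FEt mul1mx -mulmxA EFt mulmx1.
  rewrite P0 mulmx0 mul0mx => /matrixP/(_ 0 1); rewrite /base_wedge wedgeE !mxE /=.
  by move/eqP; rewrite !mulr0 mulr1 subr0 eq_sym oner_eq0.
exists x, (y / s); rewrite -/S (back X) X'_block (back S) S'_block P_back.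
by rewrite mulmxDr mulmxDl -!scalemxAr -!scalemxAl scalerA divfK.
Qed.

End Frames.

(** * Curves of 2-vectors *)

Section Curves.
Context {R : realType}.
Implicit Types (P Q X Y Z : 'M[R]_4) (gamma : R^o -> 'M[R]_4).

Lemma is_derive_mx gamma Q (t v : R^o) :
  is_derive t v gamma Q <-> forall i j, is_derive t v (fun s => gamma s i j) (Q i j).
Proof.
split=> [[dg <-] i j|h].
  split; first exact: (derivable_mxP _ _ _).1.
  by rewrite (derive_mx dg) mxE.
have dg : derivable gamma t v by apply/derivable_mxP => i j; have [] := h i j.
split=> //; rewrite (derive_mx dg); apply/matrixP => i j; rewrite mxE.
by have [_ ->] := h i j.
Qed.

(** The product rule, applied to the expansion of [B] over the base matrices
   in its first argument. *)
Lemma is_derive_quadratic (B : 'M[R]_4 -> 'M[R]_4 -> R) gamma Q (t v : R^o) :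
    (forall X Y Z, B (X + Y) Z = B X Z + B Y Z) ->
    (forall a X Y, B (a *: X) Y = a * B X Y) ->
    (forall X Y Z, B X (Y + Z) = B X Y + B X Z) ->
    (forall a X Y, B X (a *: Y) = a * B X Y) ->
    is_derive t v gamma Q ->
  is_derive t v (fun s => B (gamma s) (gamma s)) (B Q (gamma t) + B (gamma t) Q).
Proof.
move=> BDl BZl BDr BZr dg; have {}dg := (is_derive_mx _ _ _ _).1 dg.
have expand (L : 'M[R]_4 -> R) M : (forall X Y, L (X + Y) = L X + L Y) ->
    (forall a X, L (a *: X) = a * L X) ->
    L M = \sum_i \sum_j M i j * L (delta_mx i j).
  move=> LD LZ; have L0 : L 0 = 0 by rewrite -(scale0r 0) LZ mul0r.
  rewrite {1}(matrix_sum_delta M) (big_morph L LD L0); apply: eq_bigr => i _.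
  by rewrite (big_morph L LD L0); apply: eq_bigr => j _.
have dL (L : 'M[R]_4 -> R) : (forall X Y, L (X + Y) = L X + L Y) ->
    (forall a X, L (a *: X) = a * L X) ->
    is_derive t v (fun s => L (gamma s)) (L Q).
  move=> LD LZ; rewrite (expand L Q) //.
  rewrite (_ : (fun s => _) = fun s => \sum_i \sum_j gamma s i j * L (delta_mx i j)).
    apply: is_derive_bigsum => i; apply: is_derive_bigsum => j.
    have := is_deriveM (dg i j) (is_derive_cst (L (delta_mx i j)) t v).
    by rewrite scaler0 add0r => /is_derive_eq; apply; exact: mulrC.
  by apply/funext => s; exact: expand.
rewrite (expand (B^~ (gamma t)) Q) // (expand (B^~ Q) (gamma t)) // -big_split /=.
rewrite (_ : (fun s => _) = fun s => \sum_i \sum_j gamma s i j * B (delta_mx i j) (gamma s)).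
  apply: is_derive_bigsum => i; rewrite -big_split /=; apply: is_derive_bigsum => j.
  have := is_deriveM (dg i j) (dL (B (delta_mx i j)) (BDr _) (fun a => BZr a _)).
  by move=> /is_derive_eq; apply; rewrite addrC; congr (_ + _); exact: mulrC.
by apply/funext => s; exact: (expand (B^~ (gamma s))).
Qed.

(** For P = v /\ w and Q = v /\ z in an orthonormal triple, this is the curve
   of the planes v /\ (cos t w + sin t z), the rotation of P about v. *)
Definition rotation_curve P Q : R^o -> 'M[R]_4 := fun t => cos t *: P + sin t *: Q.

Lemma is_derive_rotation P Q (t : R^o) :
  is_derive t 1 (rotation_curve P Q) (rotation_curve Q (- P) t).
Proof.
apply/is_derive_mx => i j; rewrite /rotation_curve.
rewrite (_ : (fun s => _) = fun s => cos s * P i j + sin s * Q i j); last first.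
  by apply/funext => s; rewrite !mxE.
have dc := is_deriveM (is_derive_cos t) (is_derive_cst (P i j) t 1).
have ds := is_deriveM (is_derive_sin t) (is_derive_cst (Q i j) t 1).
have := is_deriveD dc ds; move=> /is_derive_eq; apply.
by rewrite !scaler0 !add0r !mxE /cst /GRing.scale /=; ring.
Qed.

Lemma derive_rotation P Q (t v : R^o) :
  'D_v (rotation_curve P Q) t = rotation_curve (v *: Q) (- (v *: P)) t.
Proof.
have [d1 E1] := is_derive_rotation P Q t.
have /derivable1_diffP df := d1.
have vE : v = v *: (1 : R^o) by rewrite /GRing.scale /= mulr1.
rewrite deriveE // {1}vE linearZ /= -deriveE // E1 /rotation_curve.
by apply/matrixP => i j; rewrite !mxE; ring.
Qed.

(** The family of these curves is closed under differentiation. *)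
Lemma smooth_rotation P Q : smooth_on setT (rotation_curve P Q).
Proof.
have df P' Q' (t : R^o) : differentiable (rotation_curve P' Q') t.
  by apply/derivable1_diffP; have [] := is_derive_rotation P' Q' t.
move=> k; elim: k P Q => [|k IH] P Q /=; first by
  move=> t _; exact: differentiable_continuous.
split=> [t _|v]; first exact: df.
rewrite (_ : (fun t => _) = rotation_curve (v *: Q) (- (v *: P))); first exact: IH.
by apply/funext => t; exact: derive_rotation.
Qed.

End Curves.

(** * Critical points of the sectional curvature *)

Section SectionalCurvature.
Context {R : realType} {M : oriented_manifold4 R}.
Variables (g : riemannian_metric M) (p : M) (phi : chart R M).
Hypotheses (atlas_phi : atlas phi) (p_phi : cdom phi p).
Implicit Types (P Q X Y : 'M[R]_4) (v w z : 'rV[R]_4).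

Local Notation G := (g_at g phi p).
Local Notation A := (curvature_operator g phi p).

Let phi_p : ccod phi (phi p). Proof. by exists p. Qed.

Lemma g_at_sym : G^T = G.
Proof. exact: gcoord_sym. Qed.

Lemma g_at_pos v : v != 0 -> 0 < ip G v v.
Proof. exact: gcoord_pos. Qed.

Lemma g_at_unit : G \in unitmx.
Proof. exact: (metric_unit g_at_pos). Qed.

Let oU : open (ccod phi).
Proof. exact: ccod_open. Qed.

Let smG : smooth_on (ccod phi) (g phi).
Proof. exact: gcoord_smooth. Qed.

Let symG y : ccod phi y -> (g phi y)^T = g phi y.
Proof. exact: gcoord_sym. Qed.

Let uG y : ccod phi y -> g phi y \in unitmx.
Proof. by move=> Uy; apply: metric_unit => v; exact: gcoord_pos. Qed.

Lemma curvature_operator_2vector X : is_2vector (A X).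
Proof.
apply: curv_op_2vector => i j k l.
exact: (riemann_base_skew oU smG symG uG).
Qed.

Lemma curvature_operator_selfadjoint X Y : ip2 G (A X) Y = ip2 G (A Y) X.
Proof.
apply: (curv_op_selfadjoint g_at_sym g_at_unit) => i j k l.
exact: (riemann_base_pair oU smG symG uG).
Qed.

(** Self-adjointness of the curvature operator [A] makes [2 *: A P] the
   gradient of sec at [P]. *)
Lemma is_derive_sec gamma Q (t v : R^o) : is_derive t v gamma Q ->
  is_derive t v (fun s => sec g phi p (gamma s)) (2 * ip2 G (A (gamma t)) Q).
Proof.
move=> dg.
have -> : 2 * ip2 G (A (gamma t)) Q = ip2 G (A Q) (gamma t) + ip2 G (A (gamma t)) Q.
  by rewrite (curvature_operator_selfadjoint Q); ring.
apply: (is_derive_quadratic (B := fun X Y => ip2 G (A X) Y)) => //.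
- by move=> X Y Z; rewrite /curvature_operator curv_opD ip2Dl.
- by move=> a X Y; rewrite /curvature_operator curv_opZ ip2Zl.
- by move=> X Y Z; rewrite ip2C ?ip2Dl ?(ip2C _ (A X)) //; exact: g_at_sym.
- by move=> a X Y; rewrite ip2C ?ip2Zl ?(ip2C _ (A X)) //; exact: g_at_sym.
Qed.

(** Derivatives of the equations that cut out the Grassmannian: unit norm and
   P /\ P = 0. *)
Lemma grassmannian_tangent gamma Q :
    (forall t, grassmannian g phi p (gamma t)) ->
    is_derive (0 : R^o) (1 : R^o) gamma Q ->
  [/\ is_2vector Q, ip2 G (gamma 0) Q = 0 & wedge22 (gamma 0) Q = 0].
Proof.
move=> Ggamma dg; split.
- have [dg' E] := dg; rewrite -E (derive_mx dg'); apply/matrixP => i j; rewrite !mxE.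
  have -> : (fun t => gamma t j i) = - (fun t => gamma t i j).
    apply/funext => t; apply: (skewE i j (X := gamma t)).
    by have [[v [w ->]] _] := Ggamma t; exact: wedge_2vector.
  by rewrite deriveN //; exact: (derivable_mxP _ _ _).1.
- have ip2Dr X Y Z : ip2 G X (Y + Z) = ip2 G X Y + ip2 G X Z.
    by rewrite !(ip2C g_at_sym X) ip2Dl.
  have ip2Zr a X Y : ip2 G X (a *: Y) = a * ip2 G X Y.
    by rewrite !(ip2C g_at_sym X) ip2Zl.
  have [_] := is_derive_quadratic (ip2Dl (G := G)) (ip2Zl (G := G)) ip2Dr ip2Zr dg.
  rewrite (_ : (fun s => _) = cst 1); last first.
    by apply/funext => t; have [_ ->] := Ggamma t.
  rewrite derive_cst (ip2C g_at_sym Q) -mulr2n => /esym/eqP.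
  by rewrite mulrn_eq0 => /eqP.
- have w22Dl X Y Z : wedge22 (X + Y) Z = wedge22 X Z + wedge22 Y Z :> R.
    by rewrite !(wedge22C _ Z) wedge22Dr.
  have w22Zl a X Y : wedge22 (a *: X) Y = a * wedge22 X Y :> R.
    by rewrite !(wedge22C _ Y) wedge22Zr.
  have [_] := is_derive_quadratic w22Dl w22Zl (@wedge22Dr R) (@wedge22Zr R) dg.
  rewrite (_ : (fun s => _) = cst 0); last first.
    by apply/funext => t; have [[v [w ->]] _] := Ggamma t; rewrite wedge22_self.
  rewrite derive_cst (wedge22C Q) -mulr2n => /esym/eqP.
  by rewrite mulrn_eq0 => /eqP.
Qed.

Lemma sec_critical_variation v w z : sec_critical g phi p (wedge v w) ->
    ip G v v = 1 -> ip G w w = 1 -> ip G z z = 1 ->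
    ip G v w = 0 -> ip G v z = 0 -> ip G w z = 0 ->
  ip2 G (A (wedge v w)) (wedge v z) = 0.
Proof.
move=> [_ crit] vv ww zz vw vz wz.
pose gamma := rotation_curve (wedge v w) (wedge v z).
have gamma0 : gamma 0 = wedge v w.
  by rewrite /gamma /rotation_curve cos0 sin0 scale1r scale0r addr0.
have Ggamma t : grassmannian g phi p (gamma t).
  have -> : gamma t = wedge v (cos t *: w + sin t *: z).
    by rewrite wedgeDr !wedgeZr.
  split; first by exists v, (cos t *: w + sin t *: z).
  have symg := g_at_sym.
  rewrite ip2_wedge vv mul1r !(ipDr, ipDl, ipZl, ipZr) // vw vz ww zz (ipC symg z) wz.
  by rewrite !mulr0 !addr0 mul0r subr0 add0r !mulr1 -!expr2 cos2Dsin2.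
have [_ E] := crit _ (smooth_rotation _ _) Ggamma gamma0.
have [_] := is_derive_sec (is_derive_rotation (wedge v w) (wedge v z) 0).
rewrite E -/gamma gamma0 /rotation_curve cos0 sin0 scale1r scale0r addr0.
by move=> /esym/eqP; rewrite mulf_eq0 pnatr_eq0 => /eqP.
Qed.

(** The tangent space of the Grassmannian at [P] is the orthogonal complement
   of [P] and its star.  For an orthonormal frame that starts with a basis of [P], it
   is spanned by the velocities of the rotations of [P] about one of its two basis
   vectors towards one of the two remaining frame vectors. *)
Lemma sec_criticalP P : grassmannian g phi p P ->
  sec_critical g phi p P <-> exists a b, A P = a *: P + b *: star (G *m P *m G).
Proof.
move=> GP; have [[v0 [w0 PE]] P1] := GP; split=> [crit|[a [b AP]]].
  rewrite PE in P1.
  have [v [w [vw0E vv ww vw]]] := unit_wedge_orthonormal g_at_sym g_at_pos P1.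
  rewrite {}vw0E in PE; move: crit; rewrite PE => crit.
  have [E [EGE rv rw]] := orthonormal_frame g_at_sym g_at_pos vv ww vw.
  have ipE i j : ip G (row i E) (row j E) = (i == j)%:R.
    transitivity ((E *m G *m E^T) i j); last by rewrite EGE mxE.
    by rewrite /ip -row_mul mxE [RHS]mxE; apply: eq_bigr => k _; rewrite !mxE.
  rewrite -rv -rw; apply: (frame_expansion g_at_sym g_at_unit EGE) => [|i j i2 j2].
    exact: curvature_operator_2vector.
  have i01 : i = 0 \/ i = 1.
    by case: i i2 => [[|[|]]] // Hi _; [left|right]; exact/val_inj.
  have jv : (0 == j) = false by apply/eqP => j0; rewrite -j0 in j2.
  have jw : (1 == j) = false by apply/eqP => j0; rewrite -j0 in j2.
  have jj := ipE j j; rewrite eqxx in jj.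
  have vj := ipE 0 j; rewrite jv rv in vj.
  have wj := ipE 1 j; rewrite jw rw in wj.
  rewrite rv rw; case: i01 => ->; rewrite ?rv ?rw.
    exact: sec_critical_variation.
  (* A rotation about [w] is handled through v /\ w = w /\ (- v). *)
  have NvE : wedge v w = wedge w (-1 *: v) by rewrite wedgeZr scaleN1r -wedgeC.
  rewrite NvE; rewrite NvE in crit; have symg := g_at_sym.
  apply: sec_critical_variation => //; rewrite ?ipZr ?ipZl ?ipZr ?vv ?vj //.
  - by rewrite !mulN1r opprK.
  - by rewrite ipC // vw mulr0.
  - by rewrite mulr0.
split=> // gamma sm Ggamma gamma0.
have dg : is_derive (0 : R^o) (1 : R^o) gamma ('D_1 gamma 0).
  by apply: derivableP; apply: diff_derivable; have [/(_ 0 I)] := sm 1.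
have [sQ ipQ wQ] := grassmannian_tangent Ggamma dg.
have := is_derive_sec dg; rewrite gamma0 AP ip2Dl !ip2Zl -gamma0 ipQ mulr0 add0r gamma0.
by rewrite PE star_orthogonal -?PE -?gamma0 // ?mulr0 //; exact: g_at_sym.
Qed.

End SectionalCurvature.

Theorem theorem4 (R : realType) (M : oriented_manifold4 R)
    (g : riemannian_metric M) (T : vector_field M)
    (unit_T : unit_length g T) (einstein : star_L_Einstein g T)
    (p : M) (phi : chart R M) (atlas_phi : atlas phi) (p_phi : cdom phi p)
    (P : 'M[R]_4)
    (GP : (G_plus g T phi p `|` G_minus g T phi p) P)
    (PT : plane_orthogonal (g_at g phi p) (T_at T phi p) P \/
          plane_contains (T_at T phi p) P) :
  complex_eigenvector g T phi p P <-> sec_critical g phi p P.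
Proof.
have symG := g_at_sym g atlas_phi p_phi.
have uG := g_at_unit g atlas_phi p_phi.
have TT := unit_T phi p atlas_phi p_phi.
have decP : decomposable P by case: GP => -[].
have gLP : `|ip2 (gL_at g T phi p) P P| = 1.
  by case: GP => -[_ ->]; rewrite ?normrN normr1.
have P0 : P != 0.
  apply/eqP => P0; move: gLP; rewrite P0 /ip2 trmx0 mul0mx mxtrace0 mulr0 normr0.
  by move/eqP; rewrite eq_sym oner_eq0.
(* [e] is 1 if [P] is orthogonal to [T], and -1 if [P] contains [T]. *)
have [e ee eP] := lorentz_flip symG TT decP P0 PT.
have e0 : e != 0.
  by apply/eqP => e0; move: ee; rewrite e0 mul0r => /eqP; rewrite eq_sym oner_eq0.
have GrP : grassmannian g phi p P.
  split=> //; have [v [w PE]] := decP.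
  have := ip2_wedge_ge0 symG (g_at_pos g atlas_phi p_phi) v w; rewrite -PE => P_ge0.
  have e1 : `|e| = 1 by apply/eqP; rewrite -sqrp_eq1 // expr2 -normrM ee normr1.
  move: gLP; rewrite {1}/ip2 -/(gL_at g T phi p) eP -scalemxAr mxtraceZ mulrCA -{2}symG.
  by rewrite -/(ip2 (g_at g phi p) P P) normrM e1 mul1r ger0_norm.
pose c := dvol (gL_at g T phi p) * e.
have c0 : c != 0 by rewrite mulf_neq0 // (lorentz_dvol_neq0 symG uG TT).
have hodgeE : hodge_L g T phi p P = c *: star (g_at g phi p *m P *m g_at g phi p).
  rewrite /hodge_L /hodge -/(gL_at g T phi p) eP -[X in _ *: X]/(star _) starZ.
  by rewrite scalerA.
rewrite (sec_criticalP atlas_phi p_phi GrP); split=> [[_ _ [z AP]]|[a [b AP]]].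
  exists (complex.Re z), (complex.Im z * c).
  by rewrite AP /Defs.cscale hodgeE scalerA.
split=> //; first by have [v [w ->]] := decP; exact: wedge_2vector.
by exists (Complex a (b / c)); rewrite AP /Defs.cscale hodgeE /= scalerA divfK.
Qed.
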